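(* Let $(X,d,\delta)$ be a dilatation structure which satisfies the strong form of Axiom A2, i.e. $\delta^x_\varepsilon\delta^x_\mu u=\delta^x_{\varepsilon\mu}u$ for all $x\in X$, $\varepsilon,\mu\in\Gamma_1$ and $u\in\bar B_d(x,A)$. For $x\in X$ let $\Sigma^x(u,v)=\lim_{\varepsilon\to0}\Sigma^x_\varepsilon(u,v)$, where $\Sigma^x_\varepsilon(u,v)=\delta^x_{\varepsilon^{-1}}\,\delta_\varepsilon^{\delta^x_\varepsilon u}\,v$ (for $u,v$ sufficiently close to $x$). Then for any $x\in X$ the triple $(U(x),\Sigma^x,\delta^x)$ is a conical group (with operation $\Sigma^x$ and dilatations $\delta^x_\varepsilon$). Moreover, the left translations of this group are $d^x$-isometries.
   Context: **Parameters.** $\Gamma$ is a Hausdorff topological commutative group, written multiplicatively with neutral element $1$, with a continuous group morphism $\nu:\Gamma\to(0,+\infty)$ (multiplicative group) such that $\inf\nu(\Gamma)=0$; the basic case is $\Gamma=(0,+\infty)$, $\nu=\mathrm{id}$. $\Gamma_1=\nu^{-1}((0,1])$. ''$\varepsilon\to0$'' means $\nu(\varepsilon)\to0$; an element $0$ is adjoined to $\Gamma$ with neighbourhoods generated by $\nu^{-1}((0,a))\cup\{0\}$, $a>0$. $\mathcal O(\varepsilon)$ denotes a positive function tending to $0$ as $\varepsilon\to0$. **Dilatation structure.** $(X,d)$ is a complete, locally compact metric space (small balls are compact); $B_d(x,r)$, $\bar B_d(x,r)$ are open and closed balls. $(X,d,\delta)$ is a dilatation structure if: A0. There are constants $A>1$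 and $B$. For $\varepsilon\in\Gamma_1$, $x\in X$, the dilatation $\delta^x_\varepsilon:U(x)\to V_\varepsilon(x)$ is a homeomorphism, $\bar B_d(x,A)\subset U(x)$, and for $\nu(\varepsilon)<1$: $B_d(x,\nu(\varepsilon))\subset\delta^x_\varepsilon B_d(x,A)\subset V_\varepsilon(x)\subset U(x)$. For $\nu(\varepsilon)>1$, $\delta^x_\varepsilon:W_\varepsilon(x)\to B_d(x,B)$ is injective, continuous, with continuous inverse on its image, $W_\varepsilon(x)$ is open, $V_{\varepsilon^{-1}}(x)\subset W_\varepsilon(x)$, and $\delta^x_{\varepsilon^{-1}}\delta^x_\varepsilon u=u$ for $\varepsilon\in\Gamma_1$, $u\in U(x)$. Moreover for any compact $K\subset X$ there are $R=R(K)>0$ and $\varepsilon_0=\varepsilon_0(K)\in(0,1)$ such that for all $x\in K$, $u,v\in\bar B_d(x,R)$ and $\nu(\varepsilon)\in(0,\varepsilon_0)$: $\delta^x_\varepsilon v\in W_{\varepsilon^{-1}}(\delta^x_\varepsilon u)$. A1. $\delta^x_1=\mathrm{id}$; $\frac1{\nu(\varepsilon)}d(x,\delta^x_\varepsilon x)\to0$ as $\varepsilon\to0$, uniformly for $x$ in compact sets (strong form: $\delta^x_\varepsilon x=x$); the map $(\varepsilon,x,y)\mapsto\delta^x_\varepsilon y$ is continuous on $\mathrm{dom}\,\delta=\{(\varepsilon,x,y)\in\Gamma\times X\times X: y\in U(x)\text{ if }\nu(\varepsilon)\le1,\ y\in W_\varepsilon(x)\text{ otherwise}\}$ and extends continuously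 to the closure of $\mathrm{dom}\,\delta$ in $(\Gamma\cup\{0\})\times X\times X$, with $\lim_{\varepsilon\to0}\delta^x_\varepsilon y=x$. A2. For any compact $K$, $x\in K$, $\nu(\varepsilon),\nu(\mu)\in(0,1)$, $u,v\in\bar B_d(x,A)$: $\frac{1}{\nu(\varepsilon\mu)}|d(\delta^x_\varepsilon\delta^x_\mu u,\delta^x_\varepsilon\delta^x_\mu v)-d(\delta^x_{\varepsilon\mu}u,\delta^x_{\varepsilon\mu}v)|\le\mathcal O(\varepsilon\mu)$ (strong form: $\delta^x_\varepsilon\delta^x_\mu u=\delta^x_{\varepsilon\mu}u$ for $\varepsilon,\mu\in\Gamma_1$, $u\in\bar B_d(x,A)$). A3. For any $x$ there is a function $(u,v)\mapsto d^x(u,v)$ on $\bar B_d(x,A)^2$ with $\lim_{\varepsilon\to0}\sup\{|\frac1{\nu(\varepsilon)}d(\delta^x_\varepsilon u,\delta^x_\varepsilon v)-d^x(u,v)|:u,v\in\bar B_d(x,A)\}=0$, uniformly for $x$ in compact sets; and $d^x$ is non-degenerate ($d^x(u,v)=0\Rightarrow u=v$). A4. With $\Delta^x_\varepsilon(u,v)=\delta_{\varepsilon^{-1}}^{\delta^x_\varepsilon u}\delta^x_\varepsilon v$, the limit $\lim_{\varepsilon\to0}\Delta^x_\varepsilon(u,v)=\Delta^x(u,v)$ exists uniformly with respect to $x,u,v$ in compact sets. The limit $\Sigma^x$ of $\Sigma^x_\varepsilon$ exists, uniformly for $x,u,v$ in compact sets; $\Sigma^x(u,\cdot)$ is the inverse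 of $\Delta^x(u,\cdot)$. **Groups.** For a group $G$, $G^{(2)}=G\times G$ with operation $(x,u)(y,v)=(xy,y^{-1}uyv)$. A uniform group is a group $G$ with uniformities on $G$ and on $G^{(2)}$ such that $op(x,y)=xy$ ($G^{(2)}\to G$), $i'(x)=(x,e)$ and $i''(x)=(x,x^{-1})$ ($G\to G^{(2)}$) are uniformly continuous. A local group is a uniform space with an operation defined in a neighbourhood of $(e,e)$ which satisfies the uniform group axioms locally (near $e$). Here the uniformities are those induced by $d$. A conical group is a local group $N$ with a local action of $\Gamma$ by (local) morphisms $\delta_\varepsilon$ (each $\delta_\varepsilon$ maps a neighbourhood of $e$ to a neighbourhood of $e$, uniformly continuously in $(\varepsilon,x)$, with $\delta_\varepsilon\delta_\mu^{-1}=\delta_{\varepsilon\mu^{-1}}$ near $e$) such that $\lim_{\varepsilon\to0}\delta_\varepsilon x=e$ for any $x$ in a neighbourhood of the neutral element $e$. *)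

(* Defs.v *)
From HB Require Import structures.
From mathcomp Require Import all_boot all_order all_algebra.
From mathcomp Require Import all_classical all_reals all_analysis.

Set Implicit Arguments.
Unset Strict Implicit.
Unset Printing Implicit Defensive.

Import Order.TTheory GRing.Theory Num.Theory.
Import numFieldNormedType.Exports.

Local Open Scope classical_set_scope.
Local Open Scope ring_scope.

HB.mixin Record Group_isTopological G of Group G & Topological G := {
  mulg_continuous : continuous (fun p : G * G => (p.1 * p.2)%g) ;
  invg_continuous : continuous (fun g : G => g^-1%g)
}.

#[short(type="topologicalGroupType")]
HB.structure Definition TopologicalGroup :=
  {G of Group G & Topological G & Group_isTopological G}.

Section Scale.
Context {R : realType} {G : topologicalGroupType}.

(* The parameter group: a Hausdorff commutative topological group with a
   continuous morphism to the multiplicative group of positive reals. *)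
Record scale_morphism (nu : G -> R) : Prop := ScaleMorphism {
  scale_hausdorff : hausdorff_space G ;
  scale_comm : forall e m : G, (e * m = m * e)%g ;
  scale_gt0 : forall e, 0 < nu e ;
  scale_mul : forall e m, nu (e * m)%g = nu e * nu m ;
  scale_continuous : continuous nu ;
  scale_inf : inf (range nu) = 0
}.

(* The filter "e --> 0", i.e. nu e --> 0. *)
Definition at0 (nu : G -> R) : set_system G :=
  filter_from [set a : R | 0 < a] (fun a => [set e | nu e < a]).

(* The group with a point 0 (here None) adjoined; as nu is continuous, the sets
   containing None and some { e | nu e < a } are the neighbourhoods of None. *)
Definition adjoin0 (nu : G -> R) : Type := option G.

Definition adjoin0_open (nu : G -> R) (O : set (adjoin0 nu)) : Prop :=
  open [set e : G | O (Some e)] /\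
  (O None -> exists2 a : R, 0 < a & [set e | nu e < a] `<=` O \o Some).

End Scale.

Section Adjoin0Topology.
Context {R : realType} {G : topologicalGroupType} (nu : G -> R).

HB.instance Definition _ := Choice.copy (adjoin0 nu) (option G).

Lemma adjoin0_openT : adjoin0_open (setT : set (adjoin0 nu)).
Proof. by split=> [|_]; [exact: openT|exists 1]. Qed.

Lemma adjoin0_openI : setI_closed (@adjoin0_open R G nu).
Proof.
move=> O P [oO O0] [oP P0]; split; first exact: openI.
move=> [/O0[a a0 aO] /P0[b b0 bP]]; exists (Num.min a b).
  by rewrite lt_min a0.
by move=> e; rewrite /= lt_min => /andP[ea eb]; split; [exact: aO|exact: bP].
Qed.

Lemma adjoin0_open_bigU (I : Type) (O : I -> set (adjoin0 nu)) :
  (forall i, adjoin0_open (O i)) -> adjoin0_open (\bigcup_i O i).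
Proof.
move=> oO; split.
  rewrite (_ : [set _ | _] = \bigcup_i [set e | O i (Some e)]).
    by apply: bigcup_open => i _; exact: (oO i).1.
  by apply/seteqP; split=> e [i _ Oie]; exists i.
move=> [i _ /(oO i).2 [a a0 aO]]; exists a => // e /aO Oie.
by exists i.
Qed.

HB.instance Definition _ := isOpenTopological.Build (adjoin0 nu)
  adjoin0_openT adjoin0_openI adjoin0_open_bigU.

End Adjoin0Topology.

Definition cball {R : realType} {X : metricType R} (x : X) (r : R) : set X :=
  [set y | mdist x y <= r].

Definition homeo_on {S T : topologicalType} (A : set S) (B : set T)
    (f : S -> T) : Prop :=
  [/\ set_bij A B f, {within A, continuous f} &
      exists2 g : T -> S, {within B, continuous g} &
        forall u, A u -> g (f u) = u].

Section DilatationStructure.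
Context {R : realType} {G : topologicalGroupType} (nu : G -> R)
  (X : metricType R).

(* Partial maps are represented by total functions together with their
   domains: [dil e x] is meaningful only on [dil_dom e x] below, and
   [tdist x] only on pairs of points of [cball x dilA]. *)
Record dilatation_data := DilatationData {
  dilA : R ;
  dilB : R ;
  dilU : X -> set X ;
  dilV : G -> X -> set X ;
  dilW : G -> X -> set X ;
  dil : G -> X -> X -> X ;
  dilR : set X -> R ;          (* R(K), K compact *)
  dile0 : set X -> R ;         (* epsilon_0(K), K compact *)
  tdist : X -> X -> X -> R     (* tdist x u v = d^x(u, v) *)
}.

Variable D : dilatation_data.
Local Notation A := (dilA D).
Local Notation B := (dilB D).
Local Notation U := (dilU D).
Local Notation V := (dilV D).
Local Notation W := (dilW D).
Local Notation delta := (dil D).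
Local Notation dx := (tdist D).

Definition dil_dom (e : G) (x : X) : set X :=
  if nu e <= 1 then U x else W e x.

Definition dom_delta : set (G * X * X) := [set p | dil_dom p.1.1 p.1.2 p.2].

Definition dom_delta0 : set (adjoin0 nu * X * X) :=
  [set (Some p.1.1 : adjoin0 nu, p.1.2, p.2) | p in dom_delta].

Definition diff_eps (e : G) (x u v : X) : X :=
  delta e^-1%g (delta e x u) (delta e x v).

Definition sum_eps (e : G) (x u v : X) : X :=
  delta e^-1%g x (delta e (delta e x u) v).

Definition sum_defined (e : G) (x u v : X) : Prop :=
  [/\ dil_dom e x u, dil_dom e (delta e x u) v &
      dil_dom e^-1%g x (delta e (delta e x u) v)].

(* Sigma^x(u, v), the limit of [sum_eps e x u v] as e --> 0 (unique since X is
   Hausdorff); the value x is a dummy one used where the limit does not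
   exist. *)
Definition sum_lim (x u v : X) : X :=
  xget x [set w | sum_eps e x u v @[e --> at0 nu] --> w].

Record axiomA0 : Prop := AxiomA0 {
  A0_gt1 : 1 < A ;
  A0_homeo : forall e x, nu e <= 1 -> homeo_on (U x) (V e x) (delta e x) ;
  A0_cball : forall x, cball x A `<=` U x ;
  A0_incl : forall e x, nu e < 1 ->
    [/\ ball x (nu e) `<=` delta e x @` ball x A,
        delta e x @` ball x A `<=` V e x & V e x `<=` U x] ;
  A0_expand : forall e x, 1 < nu e ->
    [/\ delta e x @` W e x `<=` ball x B,
        homeo_on (W e x) (delta e x @` W e x) (delta e x),
        open (W e x) & V e^-1%g x `<=` W e x] ;
  A0_cancel : forall e x u, nu e <= 1 -> U x u ->
    delta e^-1%g x (delta e x u) = u ;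
  A0_local : forall K : set X, compact K ->
    [/\ 0 < dilR D K, 0 < dile0 D K < 1 &
      forall x, K x ->
        cball x (dilR D K) `<=` U x /\
        forall u v e, cball x (dilR D K) u -> cball x (dilR D K) v ->
          nu e < dile0 D K -> W e^-1%g (delta e x u) (delta e x v)]
}.

Record axiomA1 : Prop := AxiomA1 {
  A1_id : forall x u, U x u -> delta 1%g x u = u ;
  A1_base : forall K : set X, compact K -> forall r : R, 0 < r ->
    \forall e \near at0 nu, forall x, K x ->
      (nu e)^-1 * mdist x (delta e x x) <= r ;
  A1_continuous :
    {within dom_delta, continuous (fun p => delta p.1.1 p.1.2 p.2)} ;
  A1_extension : exists dbar : adjoin0 nu * X * X -> X,
    (forall e x y, dom_delta (e, x, y) ->
       dbar (Some e : adjoin0 nu, x, y) = delta e x y) /\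
    {within closure dom_delta0, continuous dbar} ;
  A1_lim : forall x y, U x y -> delta e x y @[e --> at0 nu] --> x
}.

Definition axiomA2 : Prop :=
  forall K : set X, compact K ->
  exists O : G -> R,
    [/\ forall e, 0 < O e, O e @[e --> at0 nu] --> (0 : R) &
      forall x e m u v, K x -> nu e < 1 -> nu m < 1 ->
        cball x A u -> cball x A v ->
        (nu (e * m)%g)^-1 *
          `|mdist (delta e x (delta m x u)) (delta e x (delta m x v)) -
            mdist (delta (e * m)%g x u) (delta (e * m)%g x v)|
        <= O (e * m)%g].

Definition axiomA2_strong : Prop :=
  forall x e m u, nu e <= 1 -> nu m <= 1 -> cball x A u ->
    delta e x (delta m x u) = delta (e * m)%g x u.

Record axiomA3 : Prop := AxiomA3 {
  A3_lim : forall K : set X, compact K -> forall r : R, 0 < r ->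
    \forall e \near at0 nu, forall x u v, K x -> cball x A u -> cball x A v ->
      `|(nu e)^-1 * mdist (delta e x u) (delta e x v) - dx x u v| <= r ;
  A3_nondegenerate : forall x u v, cball x A u -> cball x A v ->
    dx x u v = 0 -> u = v
}.

(* [diff_eps e x u v] is defined for small e when x is in K and u, v are in
   the ball of centre x and radius R(K); uniformity is required on compact
   subsets of this set of triples (x, u, v). *)
Definition axiomA4 : Prop :=
  exists Delta : X -> X -> X -> X,
  forall (K : set X) (C : set (X * X * X)), compact K -> compact C ->
    C `<=` [set p | [/\ K p.1.1, cball p.1.1 (dilR D K) p.1.2
                      & cball p.1.1 (dilR D K) p.2]] ->
    forall r : R, 0 < r ->
    \forall e \near at0 nu, forall x u v, C (x, u, v) ->
      mdist (diff_eps e x u v) (Delta x u v) <= r.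

Record dilatation_structure : Prop := DilatationStructure {
  dil_complete : forall F : set_system X, ProperFilter F -> cauchy F ->
    exists l : X, F --> l ;
  dil_locally_compact : locally_compact [set: X] ;
  dil_A0 : axiomA0 ;
  dil_A1 : axiomA1 ;
  dil_A2 : axiomA2 ;
  dil_A3 : axiomA3 ;
  dil_A4 : axiomA4
}.

End DilatationStructure.

Arguments dilatation_data {R} G X.

Definition unif_continuous_on {S T : uniformType} (N : set S) (f : S -> T) :=
  unif_continuous (f : subspace N -> T).

Section LocalGroups.
Context {T : uniformType}.

(* A local group with carrier S (a neighbourhood of e in T), whose operation op
   is defined on M.  [lg_op], [lg_i1], [lg_inv] contain the local versions of
   the three axioms of a uniform group: uniform continuity of op (x, y) = xy,
   i' x = (x, e) and i'' x = (x, x^-1), the uniformity on pairs being the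
   product one. *)
Record local_group (S : set T) (e : T) (M : set (T * T)) (op : T -> T -> T)
    : Prop := LocalGroup {
  lg_carrier : nbhs e S ;
  lg_dom : nbhs (e, e) M ;
  lg_closed : forall u v, M (u, v) -> [/\ S u, S v & S (op u v)] ;
  lg_unit : \forall u \near e,
    [/\ M (e, u), op e u = u, M (u, e) & op u e = u] ;
  lg_assoc : \forall p \near (e, e, e), let: (u, v, w) := p in
    [/\ M (u, v), M (op u v, w), M (v, w), M (u, op v w) &
        op (op u v) w = op u (op v w)] ;
  lg_op : exists2 N, nbhs (e, e) N &
    unif_continuous_on N (fun p : T * T => op p.1 p.2) ;
  lg_i1 : exists2 N, nbhs e N & unif_continuous_on N (fun u : T => (u, e)) ;
  lg_inv : exists inv : T -> T,
    [/\ inv e = e,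
        \forall u \near e,
          [/\ M (u, inv u), op u (inv u) = e, M (inv u, u) &
              op (inv u) u = e] &
        exists2 N, nbhs e N & unif_continuous_on N (fun u : T => (u, inv u))]
}.

(* A local action of the topological group G on the pointed uniform space
   (S, e), the transformation [act g] being defined on [Dom g].  Uniform
   continuity in (g, u) refers to the uniformity of the commutative topological
   group G.  In [la_mul], z is the image of u under the inverse of act h. *)
Record local_action {G : topologicalGroupType} (S : set T) (e : T)
    (Dom : G -> set T) (act : G -> T -> T) : Prop := LocalAction {
  la_dom : forall g, nbhs e (Dom g) /\ Dom g `<=` S ;
  la_image : forall g, nbhs e (act g @` Dom g) /\ act g @` Dom g `<=` S ;
  la_fix : forall g, act g e = e ;
  la_inj : forall g, set_inj (Dom g) (act g) ;
  la_unif : forall E : set (T * T), entourage E ->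
    exists2 N : set G, nbhs 1%g N & exists2 E' : set (T * T), entourage E' &
      forall g h u v, Dom g u -> Dom h v -> N (g * h^-1)%g -> E' (u, v) ->
        E (act g u, act h v) ;
  la_mul : forall g h, \forall u \near e, exists z,
    [/\ Dom h z, act h z = u, Dom g z, Dom (g * h^-1)%g u &
        act g z = act (g * h^-1)%g u]
}.

Record conical_group {R : realType} {G : topologicalGroupType} (nu : G -> R)
    (S : set T) (e : T) (M : set (T * T)) (op : T -> T -> T)
    (Dom : G -> set T) (act : G -> T -> T) : Prop := ConicalGroup {
  cg_group : local_group S e M op ;
  cg_action : local_action S e Dom act ;
  cg_morphism : forall g, \forall p \near (e, e), let: (u, v) := p in
    [/\ M (u, v) /\ M (act g u, act g v), Dom g u, Dom g v, Dom g (op u v) &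
        act g (op u v) = op (act g u) (act g v)] ;
  cg_contract : exists2 N, nbhs e N &
    (\forall g \near at0 nu, N `<=` Dom g) /\
    forall u, N u -> act g u @[g --> at0 nu] --> e
}.

End LocalGroups.

Section Isometry.
Context {T : Type} {R : realType}.

(* f is an isometry on Q for the distance d, which is defined on P only. *)
Definition isometry_on (P : set T) (d : T -> T -> R) (Q : set T) (f : T -> T) :
    Prop :=
  [/\ Q `<=` P, f @` Q `<=` P &
      forall v w, Q v -> Q w -> d (f v) (f w) = d v w].

End Isometry.

(* Main.v *)
Require Import Defs.
From mathcomp Require Import all_boot all_order all_algebra.
From mathcomp Require Import all_classical all_reals all_analysis.
From mathcomp Require Import lra.

Set Implicit Arguments.
Unset Strict Implicit.
Unset Printing Implicit Defensive.

Import Order.TTheory GRing.Theory Num.Theory.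
Import numFieldNormedType.Exports.

Local Open Scope classical_set_scope.
Local Open Scope ring_scope.

(** Write Delta_e(u, v) for [diff_eps e x u v]. Strong A2 forces every
    dilatation to fix its centre and makes delta_h scale the tangent distance
    d^x by nu(h). By A3, d(delta_e^y u, delta_e^y v) < nu(e) for y, u, v near x,
    so by A0 the point delta_e^y v is in the range of the dilatation centred at
    delta_e^y u; hence delta_e^(delta_e^x u) Delta_e(u, v) = delta_e^x v. In the
    limit, Delta(u, .) is a d^x-isometry,
    Delta(Delta(u, v), Delta(u, w)) = Delta(v, w), Delta(x, v) = v,
    Delta(u, u) = x, and Delta commutes with the dilatations. The points
    w_e = Sigma_e(u, v) solve Delta_e(u, w_e) = v in a compact ball, so they
    converge to the unique w with Delta(u, w) = v. Thus Sigma(u, .) inverts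
    Delta(u, .), and the group laws are the relations above, with
    u^-1 = Delta(u, x). *)

(** * Metric and uniform facts *)

(** Strong A2 composes contractions only. Composition laws and distance estimates for an expanding g
    are therefore obtained after a contraction j so small that j g contracts too; they are brought
    back because contractions are injective and scale d^x exactly. The uniformities are those of d,
    whereas left translations preserve d^x: on a small compact ball each distance controls the
    other, which converts identities for d^x into limits and uniform continuity for d. Compactness
    is available in X but not in the parameter group, so bounds over all group elements must come
    from scaling. *)

Section MetricFacts.
Context {R : realType} {X : metricType R}.
Implicit Types (x y u v : X) (r : R).

Lemma near_mdistP x (P : X -> Prop) :
  (\forall u \near x, P u) <->
  exists2 s : R, 0 < s & forall u, mdist x u < s -> P u.
Proof.
split=> [/metricType_numDomainType.nbhs_mdistP[s s0 sP]|[s s0 sP]].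
  by exists s => // u; exact: sP.
by apply/metricType_numDomainType.nbhs_mdistP; exists s.
Qed.

Lemma near_mdist_lt x r : 0 < r -> \forall u \near x, mdist x u < r.
Proof. by move=> r0; apply/near_mdistP; exists r. Qed.

Lemma cvg_mdistP {T} {F : set_system T} {FF : Filter F} (f : T -> X) y :
  f @ F --> y <-> forall e : R, 0 < e -> \forall t \near F, mdist y (f t) < e.
Proof. exact: metricType_numDomainType.cvgrPdist_lt. Qed.

Lemma mdist_quad x y u v : `|mdist x y - mdist u v| <= mdist x u + mdist y v.
Proof.
have := metric_triangle x u y; have := metric_triangle u v y.
have := metric_triangle u x v; have := metric_triangle x y v.
rewrite (metric_sym u x) (metric_sym v y) ler_norml; lra.
Qed.

Lemma cvg_mdist {T} {F : set_system T} {FF : Filter F} (f g : T -> X) y z :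
  f @ F --> y -> g @ F --> z -> mdist (f t) (g t) @[t --> F] --> mdist y z.
Proof.
move=> /cvg_mdistP fy /cvg_mdistP gz; apply/cvgrPdist_lt => e e0.
have e20 : 0 < e / 2 by rewrite divr_gt0.
apply: filterS2 (fy _ e20) (gz _ e20) => t fte gte.
by apply: (le_lt_trans (mdist_quad _ _ _ _)); lra.
Qed.

Lemma cvg_near_ball {T} {F : set_system T} {FF : Filter F} (f : T -> X) x y r :
  f @ F --> y -> mdist x y < r -> \forall t \near F, mdist x (f t) < r.
Proof. by move=> fy xy; exact: cvgr_lt _ (cvg_mdist (cvg_cst x) fy) _ xy. Qed.

Lemma closed_cball x r : closed (cball x r).
Proof.
rewrite (_ : cball x r = mdist x @^-1` [set t | t <= r])//.
apply: closed_comp => [u _|]; last exact: closed_le.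
by apply: cvg_mdist; [exact: cvg_cst|exact: cvg_id].
Qed.

Lemma compact_cballW x r s : s <= r ->
  compact (cball x r) -> compact (cball x s).
Proof.
move=> sr cr; apply: (subclosed_compact _ cr); first exact: closed_cball.
by move=> u /= /le_trans; exact.
Qed.

End MetricFacts.

Lemma cvg_near_eq {T : Type} {Y : topologicalType} {F : set_system T}
    {FF : Filter F} (f g : T -> Y) (l : Y) :
  (\forall t \near F, f t = g t) -> f @ F --> l -> g @ F --> l.
Proof.
by move=> fg; apply: cvg_trans; apply: near_eq_cvg; apply: filterS fg => t ->.
Qed.

(** Near a point where [f] vanishes, [g < e] by continuity; near any other point [f] stays above
    [f p / 2], and a smaller [h] makes the implication vacuous. Compactness makes one [h] serve all
    of [K]. Used to compare two distances in either direction. *)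
Lemma compact_modulus {R : realType} {T : topologicalType} (K : set T)
    (f g : T -> R) :
  compact K ->
  (forall p, K p -> f t @[t --> within K (nbhs p)] --> f p) ->
  (forall p, K p -> g t @[t --> within K (nbhs p)] --> g p) ->
  (forall p, K p -> 0 <= f p) ->
  (forall p, K p -> f p = 0 -> g p <= 0) ->
  forall e : R, 0 < e ->
    exists2 h : R, 0 < h & forall p, K p -> f p < h -> g p < e.
Proof.
move=> cK fc gc f0 fg e e0.
have /compact_near_coveringP/near_covering_withinP := cK.
move=> /(_ R (0^'+) (fun h p => f p < h -> g p < e) _).
have near_p : forall p, K p ->
    \forall p' \near p & h \near (0 : R)^'+, K p' -> f p' < h -> g p' < e.
  move=> p Kp; have [fp0|fp0] := eqVneq (f p) 0.
    have gpe : g p < e by apply: le_lt_trans e0; exact: fg.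
    have gne := cvgr_lt _ (gc p Kp) _ gpe.
    exists ([set q | K q -> g q < e], setT) => /=.
      by split; [exact: gne|exact: filterT].
    by move=> [q h] /= [gq _] Kq _; exact: gq.
  have fp : 0 < f p by rewrite lt_def fp0 f0.
  have fp2 : f p / 2 < f p by lra.
  exists ([set q | K q -> f p / 2 < f q], [set h | h < f p / 2]) => /=.
    by split; [exact: (cvgr_gt _ (fc p Kp) _ fp2)|apply: nbhs_right_lt; lra].
  by move=> [q h] /= [fq hp] Kq; move: (fq Kq) => /lt_trans/[apply]; lra.
move=> /(_ near_p) Kmod.
have [h [h0 hK]] := filter_ex (filterI (nbhs_right_gt (0 : R)) Kmod).
by exists h.
Qed.

Lemma unif_continuous_on_ball {R : realType} {S T : pseudoMetricType R}
    (N : set S) (f : S -> T) :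
  (forall h : R, 0 < h -> exists2 k : R, 0 < k &
    forall p q, N p -> N q -> ball p k q -> ball (f p) h (f q)) ->
  unif_continuous_on N f.
Proof.
move=> fP E; rewrite -entourage_ballE => -[h h0 hE]; have [k k0 kP] := fP h h0.
exists [set pq | ball pq.1 k pq.2]; first by rewrite -entourage_ballE; exists k.
(* Entourages of the subspace uniformity relate each point to itself, even outside [N]; hence the
   diagonal case. *)
move=> [p q] /= [->|[Np [Nq pq]]]; apply: hE => /=; first exact: ballxx.
exact: kP.
Qed.

Section UniformLimit.
Context {R : realType} {I : Type} {T : topologicalType}
  {Y : pseudoMetricType R} (A : set_system I) {FA : ProperFilter A}
  (S : set T) (f : I -> T -> Y) (f0 : T -> Y) (p : T).
Hypothesis unif : forall r : R, 0 < r ->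
  \forall i \near A, forall t, S t -> ball (f0 t) r (f i t).
Hypothesis cont : \forall i \near A, f i t @[t --> within S (nbhs p)] --> f i p.
Hypothesis Sp : S p.

Lemma unif_limit_within : f0 t @[t --> within S (nbhs p)] --> f0 p.
Proof.
apply/cvg_ballP => r r0; have r30 : 0 < r / 3 by rewrite divr_gt0.
have [i [ui ci]] := filter_ex (filterI (unif r30) cont).
have /cvg_ballP/(_ _ r30) := ci; rewrite !near_withinE; apply: filterS => t fit St.
have -> : r = r / 3 + r / 3 + r / 3 by lra.
apply: ball_triangle (ball_sym (ui _ St)).
by apply: ball_triangle (fit St); exact: ui.
Qed.

(** Index and argument may move together, as when the centre of a dilatation tends to [x] while its
    coefficient tends to 0. *)
Lemma unif_limit_diag {J} (B : set_system J) {FB : Filter B}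
    (i : J -> I) (t : J -> T) :
  i @ B --> A -> t @ B --> p -> (\forall j \near B, S (t j)) ->
  f (i j) (t j) @[j --> B] --> f0 p.
Proof.
move=> iA tp St; apply/cvg_ballP => r r0.
have r20 : 0 < r / 2 by rewrite divr_gt0.
have /cvg_ballP/(_ _ r20) := unif_limit_within; rewrite near_withinE => nf0.
have nt : \forall j \near B, S (t j) -> ball (f0 p) (r / 2) (f0 (t j)).
  exact: (tp _ nf0).
have ni := iA _ (unif r20); near=> j.
have Stj : S (t j) by near: j.
rewrite [r]splitr; apply: (@ball_triangle _ _ (f0 (t j))).
  by move: Stj; near: j.
by move: (t j) Stj; near: j.
Unshelve. all: by end_near. Qed.

End UniformLimit.

#[global] Instance at0_filter {R : realType} {G : topologicalGroupType}
  (nu : G -> R) : Filter (at0 nu).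
Proof.
apply: filter_from_filter; first by exists 1 => /=.
move=> a b /= a0 b0; exists (Num.min a b); first by rewrite /= lt_min a0.
by move=> e /=; rewrite lt_min => /andP[].
Qed.

(** * The scale morphism *)

Section ScaleFacts.
Context {R : realType} {G : topologicalGroupType} {nu : G -> R}
  (Hnu : scale_morphism nu).

Lemma at0_lt (a : R) : 0 < a -> \forall e \near at0 nu, nu e < a.
Proof. by move=> a0; exists a. Qed.

Lemma at0_le (a : R) : 0 < a -> \forall e \near at0 nu, nu e <= a.
Proof. by move=> a0; exists a => // e /ltW. Qed.

Lemma at0_proper : ProperFilter (at0 nu).
Proof.
apply: filter_from_proper => a /= a0.
have [|r [e _ <-]] := inf_adherent (E := range nu) a0.
  by split; [exists (nu 1%g), 1%g|exists 0 => _ [e _ <-]; exact/ltW/scale_gt0].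
by rewrite (scale_inf Hnu) add0r; exists e.
Qed.

Lemma scale1 : nu 1%g = 1.
Proof.
apply: (mulfI (lt0r_neq0 (scale_gt0 Hnu 1%g))).
by rewrite -(scale_mul Hnu) mulg1 mulr1.
Qed.

Lemma scaleV e : nu e^-1%g = (nu e)^-1.
Proof.
apply: (mulfI (lt0r_neq0 (scale_gt0 Hnu e))).
by rewrite -(scale_mul Hnu) mulgV scale1 mulfV// lt0r_neq0// (scale_gt0 Hnu).
Qed.

Lemma at0_mulg h : (e * h)%g @[e --> at0 nu] --> at0 nu.
Proof.
move=> P [a /= a0 aP]; exists (a / nu h) => /= [|e /= ea].
  by rewrite divr_gt0// (scale_gt0 Hnu).
by apply: aP; rewrite /= (scale_mul Hnu) -ltr_pdivlMr ?(scale_gt0 Hnu).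
Qed.

Lemma near_scale1 : \forall k \near (1%g : G), 2^-1 < nu k < 2.
Proof.
have := @Defs.scale_continuous _ _ _ Hnu 1%g; rewrite /continuous_at scale1 => nu1.
by apply: filterS2 (cvgr_gt _ nu1 (2^-1) _) (cvgr_lt _ nu1 2 _) => [k -> ->| |]//;
  lra.
Qed.

End ScaleFacts.

(** * Dilatations and the tangent distance *)

Section DilatationFacts.
Context {R : realType} {G : topologicalGroupType} {nu : G -> R}
  (Hnu : scale_morphism nu) {X : metricType R} {D : dilatation_data G X}
  (HD : dilatation_structure nu D) (HA2 : axiomA2_strong nu D).
Local Notation A := (dilA D).
Local Notation U := (dilU D).
Local Notation delta := (dil D).
Local Notation rho := (tdist D).
Local Notation d := mdist.
Implicit Types (e g h k : G) (x y z u v w : X).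

#[local] Instance at0_proper' : ProperFilter (at0 nu) := at0_proper Hnu.
Let HA0 := dil_A0 HD.
Let HA1 := dil_A1 HD.
Let HA3 := dil_A3 HD.
Let nu_gt0 e : 0 < nu e. Proof. exact: scale_gt0. Qed.
Let nuM e h : nu (e * h)%g = nu e * nu h. Proof. exact: scale_mul. Qed.
Let nuV e : nu e^-1%g = (nu e)^-1. Proof. exact: scaleV. Qed.
Let mulgC e h : (e * h = h * e)%g. Proof. exact: (scale_comm Hnu). Qed.
Let A_gt1 : 1 < A. Proof. exact: (A0_gt1 HA0). Qed.
Let A_gt0 : 0 < A. Proof. by have := A_gt1; lra. Qed.

Lemma scale_lt_ex (a : R) : 0 < a -> exists2 e, nu e < a & nu e < 1.
Proof.
move=> a0; have /filter_ex[e] : \forall e \near at0 nu, nu e < Num.min a 1.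
  by apply: at0_lt; rewrite lt_min a0 ltr01.
by rewrite lt_min => /andP[? ?]; exists e.
Qed.

Lemma cball_dilU x u : d x u <= A -> U x u.
Proof. exact: (A0_cball HA0). Qed.

Lemma dilU_center x : U x x.
Proof. by apply: cball_dilU; rewrite mdistxx ltW. Qed.

Lemma dom_deltaE e x u : nu e <= 1 -> U x u -> dom_delta nu D (e, x, u).
Proof. by move=> e1 Uu; rewrite /dom_delta/= /dil_dom e1. Qed.

Lemma delta_dilV e x u : nu e <= 1 -> U x u -> dilV D e x (delta e x u).
Proof. by move=> e1 Uu; have [[+ _ _] _ _] := A0_homeo HA0 x e1; exact. Qed.

Lemma dilV_dilU e x : nu e < 1 -> dilV D e x `<=` U x.
Proof. by move=> e1; have [] := A0_incl HA0 x e1. Qed.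

Lemma delta_cancel e x u : nu e <= 1 -> U x u ->
  delta e^-1%g x (delta e x u) = u.
Proof. exact: (A0_cancel HA0). Qed.

Lemma delta_inj e x u v : nu e <= 1 -> U x u -> U x v ->
  delta e x u = delta e x v -> u = v.
Proof.
by move=> e1 Uu Uv uv; rewrite -(delta_cancel e1 Uu) uv delta_cancel.
Qed.

(** A1 gives continuity relative to [dom_delta] only, so each use must certify that the limit triple
    and the moving triples lie in the domain. *)
Lemma delta_cvg {T} {F : set_system T} {FF : Filter F}
    (e : T -> G) (y u : T -> X) e0 y0 u0 :
  e @ F --> e0 -> y @ F --> y0 -> u @ F --> u0 ->
  dom_delta nu D (e0, y0, u0) ->
  (\forall t \near F, dom_delta nu D (e t, y t, u t)) ->
  delta (e t) (y t) (u t) @[t --> F] --> delta e0 y0 u0.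
Proof.
move=> ee yy uu dom0 domF.
have /subspace_continuousP/(_ _ dom0) /= dc := A1_continuous HA1.
apply: (cvg_comp (fun t => (e t, y t, u t)) _ _ dc).
have pt : (e t, y t, u t) @[t --> F] --> (e0, y0, u0).
  exact: cvg_pair (cvg_pair ee yy) uu.
move=> P /pt nP; rewrite nbhs_simpl/=; near=> t.
have : dom_delta nu D (e t, y t, u t) by near: t.
by near: t.
Unshelve. all: by end_near. Qed.

Lemma delta_strong e m x u : nu e <= 1 -> nu m <= 1 -> d x u <= A ->
  delta e x (delta m x u) = delta (e * m)%g x u.
Proof. exact: HA2. Qed.

(** For a contraction [e] and [m] tending to 0, [delta e x (delta m x x)] tends to [delta e x x] by
    continuity, but strong A2 makes it the dilatation of [x] by [e * m], which tends to [x]. An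
    expanding [g] follows by cancelling its inverse. *)
Lemma delta_fix g x : delta g x x = x.
Proof.
have small e : nu e <= 1 -> delta e x x = x.
  move=> e1; have A0 : d x x <= A by rewrite mdistxx ltW.
  have to_x : delta m x x @[m --> at0 nu] --> x.
    exact: (A1_lim HA1) (dilU_center x).
  have lim1 : delta e x (delta m x x) @[m --> at0 nu] --> delta e x x.
    apply: delta_cvg => //; try exact: cvg_cst.
      exact: dom_deltaE (dilU_center x).
    have /cvg_mdistP/(_ 1 ltr01) := to_x; apply: filterS => m xm.
    by apply: dom_deltaE => //; apply: cball_dilU; move: A_gt1; lra.
  have lim2 : delta e x (delta m x x) @[m --> at0 nu] --> x.
    apply: cvg_near_eq (cvg_comp _ _ (at0_mulg Hnu e) to_x).
    near=> m => /=.
    rewrite delta_strong 1?mulgC//.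
    by near: m; exact: at0_le.
  exact: (cvg_unique (@metric_hausdorff _ X) lim1 lim2).
have [|g1] := leP (nu g) 1; first exact: small.
have gV1 : nu g^-1%g <= 1 by rewrite nuV invf_le1// ltW.
by rewrite -{2}(small _ gV1) -{1}[g]invgK delta_cancel//; exact: dilU_center.
Unshelve. all: by end_near. Qed.

Lemma near_dil_dom g x : \forall u \near x, dil_dom nu D g x u.
Proof.
rewrite /dil_dom; have [g1|g1] := leP (nu g) 1.
  by apply/near_mdistP; exists A => // u /ltW; exact: cball_dilU.
have [_ _ oW VW] := A0_expand HA0 x g1.
have gV1 : nu g^-1%g <= 1 by rewrite nuV invf_le1// ltW.
apply: open_nbhs_nbhs; split=> //; apply: VW.
by have := delta_dilV gV1 (dilU_center x); rewrite delta_fix.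
Qed.

Lemma delta_cvg_center g x : delta g x u @[u --> x] --> x.
Proof.
rewrite -{3}(delta_fix g x); apply: delta_cvg; try exact: cvg_cst.
- exact: cvg_id.
- exact: nbhs_singleton (near_dil_dom g x).
- exact: near_dil_dom.
Qed.

Lemma delta_onto e x z : nu e < 1 -> d x z < nu e ->
  exists2 w, d x w < A & delta e x w = z.
Proof.
move=> e1 xz; have [+ _ _] := A0_incl HA0 x e1.
move=> /(_ z); rewrite !ballEmdist /= => /(_ xz)[w xw wz].
by exists w.
Qed.

Lemma dil_domV e x u : nu e < 1 -> U x u -> dil_dom nu D e^-1%g x (delta e x u).
Proof.
move=> e1 Uu; have eV1 : 1 < nu e^-1%g by rewrite nuV invf_gt1.
rewrite /dil_dom leNgt eV1; have [_ _ _ VW] := A0_expand HA0 x eV1.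
by apply: VW; rewrite invgK; apply: delta_dilV => //; exact: ltW.
Qed.

Lemma rho_cvg x u v : d x u <= A -> d x v <= A ->
  (nu e)^-1 * d (delta e x u) (delta e x v) @[e --> at0 nu] --> rho x u v.
Proof.
move=> xu xv; apply/cvgrPdist_le => r r0.
have := A3_lim HA3 (@compact_set1 X x) r0; apply: filterS => e /(_ x u v).
by rewrite distrC; exact.
Qed.

Lemma rho_ge0 x u v : d x u <= A -> d x v <= A -> 0 <= rho x u v.
Proof.
move=> xu xv; apply: cvgr_to_ge (rho_cvg xu xv) _; apply: nearW => e.
by rewrite mulr_ge0 ?mdist_ge0// invr_ge0 ltW.
Qed.

Lemma rhoxx x u : d x u <= A -> rho x u u = 0.
Proof.
move=> xu; apply: (cvg_unique (@Rhausdorff R) (rho_cvg xu xu)).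
by apply: cvg_near_cst; apply: nearW => e; rewrite mdistxx mulr0.
Qed.

Lemma rho_sym x u v : d x u <= A -> d x v <= A -> rho x u v = rho x v u.
Proof.
move=> xu xv; apply: (cvg_unique (@Rhausdorff R) (rho_cvg xu xv)).
by apply: cvg_near_eq (rho_cvg xv xu); apply: nearW => e; rewrite metric_sym.
Qed.

Lemma rho_triangle x u v w : d x u <= A -> d x v <= A -> d x w <= A ->
  rho x u w <= rho x u v + rho x v w.
Proof.
move=> xu xv xw; apply: ler_cvg_to (rho_cvg xu xw)
  (cvgD (rho_cvg xu xv) (rho_cvg xv xw)) _.
apply: nearW => e /=; rewrite -mulrDr ler_pM2l ?invr_gt0//.
exact: metric_triangle.
Qed.

(** Strong A2 turns the rescaled distance of the images at [e] into [nu h] times that of [u], [v] at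
    [e * h]. *)
Lemma rho_scale h x u v : nu h <= 1 -> d x u <= A -> d x v <= A ->
  d x (delta h x u) <= A -> d x (delta h x v) <= A ->
  rho x (delta h x u) (delta h x v) = nu h * rho x u v.
Proof.
move=> h1 xu xv xhu xhv.
apply: (cvg_unique (@Rhausdorff R) (rho_cvg xhu xhv)).
have lim := cvg_comp _ _ (at0_mulg Hnu h) (rho_cvg xu xv).
apply: cvg_near_eq (cvgM (cvg_cst (nu h)) lim); near=> e.
have e1 : nu e <= 1 by near: e; exact: at0_le.
rewrite /= !delta_strong// nuM invfM mulrA mulrCA mulfV ?mulr1//.
exact: lt0r_neq0.
Unshelve. all: by end_near. Qed.

(** As [r + r <= 1 < A], every point of the compact ball can serve as a centre for all the others,
    within the range of A3. *)
Definition good_radius x (r : R) := [/\ 0 < r, r + r <= 1 & compact (cball x r)].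

Lemma good_radius_ex x : exists r, good_radius x r.
Proof.
have /(_ x I) := dil_locally_compact HD.
move=> [K nK [cK _]]; have /near_mdistP[s s0 sK] : \forall u \near x, K u.
  by apply: (@filterS _ (nbhs x) _ (fun u => [set: X] u -> K u)) nK => u; exact.
exists (Num.min (s / 2) (2^-1)); split.
- by rewrite lt_min invr_gt0 divr_gt0 /=.
- have : Num.min (s / 2) (2^-1) <= 2^-1 :> R by rewrite ge_min lexx orbT.
  lra.
- apply: (subclosed_compact (@closed_cball _ _ _ _) cK) => u /= xu.
  by apply: sK; move: xu; rewrite /cball/= le_min => /andP[+ _]; lra.
Qed.

(** * Mutual control of d and d^x on a compact ball *)

Section GoodRadius.
Context (x : X) (r : R) (xr : good_radius x r).

Let rho_eps e (p : X * X * X) : R :=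
  (nu e)^-1 * d (delta e p.1.1 p.1.2) (delta e p.1.1 p.2).

Let S : set (X * X * X) :=
  [set p | [/\ d x p.1.1 <= r, d x p.1.2 <= r & d x p.2 <= r]].

Lemma good_radius_le y u : d x y <= r -> d x u <= r -> d y u <= A.
Proof.
have [_ r1 _] := xr; move=> xy xu.
have := metric_triangle y x u; rewrite (metric_sym y x); move: A_gt1; lra.
Qed.

Let rho_eps_unif (a : R) : 0 < a ->
  \forall e \near at0 nu, forall p, S p ->
    ball (rho p.1.1 p.1.2 p.2) a (rho_eps e p).
Proof.
move=> a0; have [_ _ cK] := xr; have a20 : 0 < a / 2 by rewrite divr_gt0.
apply: filterS (A3_lim HA3 cK a20) => e eK [[y u] v] [/= xy xu xv].
rewrite /ball/= /rho_eps/= distrC.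
have := eK y u v xy (good_radius_le xy xu) (good_radius_le xy xv); lra.
Qed.

Let rho_eps_cont p : S p ->
  \forall e \near at0 nu, rho_eps e t @[t --> within S (nbhs p)] --> rho_eps e p.
Proof.
move=> [xy xu xv]; near=> e; have e1 : nu e <= 1 by near: e; exact: at0_le.
have c1 : t.1.1 @[t --> within S (nbhs p)] --> p.1.1.
  by apply: cvg_within_filter; exact: cvg_comp cvg_fst cvg_fst.
have c2 : t.1.2 @[t --> within S (nbhs p)] --> p.1.2.
  by apply: cvg_within_filter; exact: cvg_comp cvg_fst cvg_snd.
have c3 : t.2 @[t --> within S (nbhs p)] --> p.2.
  by apply: cvg_within_filter; exact: cvg_snd.
apply: cvgM; first exact: cvg_cst.
apply: cvg_mdist; apply: delta_cvg => //; try exact: cvg_cst.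
- by apply: dom_deltaE => //; apply: cball_dilU; exact: good_radius_le.
- rewrite near_withinE; apply: nearW => t [ty tu tv].
  by apply: dom_deltaE => //; apply: cball_dilU; exact: good_radius_le.
- by apply: dom_deltaE => //; apply: cball_dilU; exact: good_radius_le.
- rewrite near_withinE; apply: nearW => t [ty tu tv].
  by apply: dom_deltaE => //; apply: cball_dilU; exact: good_radius_le.
Unshelve. all: by end_near. Qed.

Lemma rho_eps_joint {J} {B : set_system J} {FB : Filter B} (e : J -> G)
    (y u v : J -> X) y0 u0 v0 :
  d x y0 < r -> d x u0 < r -> d x v0 < r ->
  e @ B --> at0 nu -> y @ B --> y0 -> u @ B --> u0 -> v @ B --> v0 ->
  (nu (e j))^-1 * d (delta (e j) (y j) (u j)) (delta (e j) (y j) (v j))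
    @[j --> B] --> rho y0 u0 v0.
Proof.
move=> xy xu xv e0 yy uu vv.
have Sp : S (y0, u0, v0) by split; exact: ltW.
apply: (unif_limit_diag rho_eps_unif (rho_eps_cont Sp) Sp e0
  (t := fun j => (y j, u j, v j))).
  exact: cvg_pair (cvg_pair yy uu) vv.
have in_ball (z : J -> X) z0 : d x z0 < r -> z @ B --> z0 ->
    \forall j \near B, d x (z j) <= r.
  by move=> xz zz; apply: filterS (cvg_near_ball zz xz) => j /ltW.
exact: filterS3 (in_ball _ _ xy yy) (in_ball _ _ xu uu) (in_ball _ _ xv vv).
Qed.

Lemma rho_within : forall p, S p ->
  rho t.1.1 t.1.2 t.2 @[t --> within S (nbhs p)] --> rho p.1.1 p.1.2 p.2.
Proof.
by move=> p Sp; exact: (unif_limit_within rho_eps_unif (rho_eps_cont Sp) Sp).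
Qed.

Let K2 : set (X * X) := cball x r `*` cball x r.

Let rho_pair p : K2 p ->
  rho x t.1 t.2 @[t --> within K2 (nbhs p)] --> rho x p.1 p.2.
Proof.
move=> [xp1 xp2]; have [r0 _ _] := xr.
have Sp : S (x, p.1, p.2) by split=> //=; rewrite mdistxx ltW.
apply: (cvg_comp (fun t => (x, t.1, t.2)) _ _ (rho_within Sp)).
have pt : (x, t.1, t.2) @[t --> nbhs p] --> (x, p.1, p.2).
  exact: cvg_pair (cvg_pair (cvg_cst x) cvg_fst) cvg_snd.
move=> P /pt; apply: (@filterS _ (nbhs p)) => t Pt [xt1 xt2].
by apply: Pt; split=> //=; rewrite mdistxx ltW.
Qed.

Let mdist_pair p : K2 p ->
  d t.1 t.2 @[t --> within K2 (nbhs p)] --> d p.1 p.2.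
Proof.
by move=> _; apply: cvg_within_filter; exact: cvg_mdist cvg_fst cvg_snd.
Qed.

Let compact_K2 : compact K2.
Proof. by have [_ _ cK] := xr; exact: compact_setX. Qed.

Lemma good_radius_center u : d x u <= r -> d x u <= A.
Proof.
have [r0 _ _] := xr; apply: good_radius_le.
by rewrite mdistxx ltW.
Qed.

Lemma rho_modulus (a : R) : 0 < a -> exists2 b : R, 0 < b &
  forall u v, d x u <= r -> d x v <= r -> d u v < b -> rho x u v < a.
Proof.
move=> a0; have [|[u v] [/= xu xv] uv|b b0 bP] :=
    compact_modulus compact_K2 mdist_pair rho_pair _ _ a0.
- by move=> p _; exact: mdist_ge0.
- by rewrite (mdist_positivity _ _ uv) rhoxx// good_radius_center.
- by exists b => // u v xu xv; exact: (bP (u, v)).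
Qed.

(** Non-degeneracy of d^x, made quantitative by compactness. *)
Lemma mdist_modulus (a : R) : 0 < a -> exists2 b : R, 0 < b &
  forall u v, d x u <= r -> d x v <= r -> rho x u v < b -> d u v < a.
Proof.
move=> a0; have [[u v] [/= xu xv]|[u v] [/= xu xv] uv|b b0 bP] :=
    compact_modulus compact_K2 rho_pair mdist_pair _ _ a0.
- by apply: rho_ge0; exact: good_radius_center.
- by rewrite (A3_nondegenerate HA3 _ _ uv) ?mdistxx//; exact: good_radius_center.
- by exists b => // u v xu xv; exact: (bP (u, v)).
Qed.

End GoodRadius.

Lemma A3_center x (a : R) : 0 < a -> exists2 b : R, 0 < b &
  forall e u, nu e < b -> d x u <= A ->
    nu e * (rho x x u - a) <= d x (delta e x u) <= nu e * (rho x x u + a).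
Proof.
move=> a0; have [b /= b0 bP] := A3_lim HA3 (@compact_set1 X x) a0.
exists b => // e u eb xu; have xx : d x x <= A by rewrite mdistxx ltW.
have := bP e eb x x u erefl xx xu; rewrite delta_fix.
rewrite ler_norml -[X in _ -> _ <= X <= _](mulVKf (lt0r_neq0 (nu_gt0 e))).
by rewrite !ler_pM2l//; lra.
Qed.

(** The ball of radius [A] need not be compact, so [mdist_modulus] cannot be applied to [u] itself.
    A fixed contraction [e] brings [u] into a compact ball, multiplies d^x by [nu e], and is undone
    by [delta e^-1 x], which is continuous at [x]. *)
Lemma rho_control x (a : R) : 0 < a -> exists2 b : R, 0 < b &
  forall u, d x u <= A -> rho x x u < b -> d x u < a.
Proof.
move=> a0; have [r xr] := good_radius_ex x; have [r0 _ _] := xr.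
have [b b0 bP] := A3_center x ltr01.
have [|e + /ltW e1] := @scale_lt_ex (Num.min b (r / 2)).
  by rewrite lt_min b0 divr_gt0.
rewrite lt_min => /andP[eb er].
have /cvg_mdistP/(_ a a0)/near_mdistP[c c0 cP] := @delta_cvg_center e^-1%g x.
have [b' b'0 b'P] := mdist_modulus xr c0.
exists (Num.min b' 1) => [|u xu]; first by rewrite lt_min b'0 ltr01.
rewrite lt_min => /andP[ub u1].
rewrite -(delta_cancel e1 (cball_dilU xu)); apply: cP.
have xeu : d x (delta e x u) <= r.
  have /andP[_ /le_trans] := bP _ _ eb xu; apply.
  have : nu e * (rho x x u + 1) <= nu e * 2 by rewrite ler_pM2l//; lra.
  lra.
apply: b'P => //; first by rewrite mdistxx ltW.
have xx : d x x <= A by rewrite mdistxx ltW.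
have := rho_scale e1 xx xu; rewrite delta_fix => -> //; last first.
  exact: (good_radius_center xr).
by apply: le_lt_trans ub; rewrite ler_piMl// rho_ge0.
Qed.

Lemma near_rho_lt x (a : R) : 0 < a -> \forall u \near x, rho x x u < a.
Proof.
move=> a0; have [r xr] := good_radius_ex x; have [r0 _ _] := xr.
have [b b0 bP] := rho_modulus xr a0.
apply/near_mdistP; exists (Num.min r b); first by rewrite lt_min r0.
move=> u; rewrite lt_min => /andP[ur ub]; apply: bP => //; last exact: ltW.
by rewrite mdistxx ltW.
Qed.

(* Comparing with [delta e x w] for one small [e], the estimate is uniform in
   [g] although [G] need not be locally compact. *)
Lemma delta_stable x (a : R) : 0 < a -> exists2 s : R, 0 < s &
  forall g u, nu g <= 1 -> d x u < s -> d x (delta g x u) < a.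
Proof.
move=> a0; have a40 : (0 : R) < 4^-1 by [].
have [b b0 bP] := A3_center x a40; have [c c0 cP] := rho_control x a0.
have [e eb e1] := scale_lt_ex b0; have le1 := ltW e1.
have [s s0 sP] : exists2 s : R, 0 < s & forall u, d x u < s ->
    [/\ d x u < nu e, d x u <= A, rho x x u < 2^-1 & rho x x u < c].
  apply/near_mdistP; near=> u.
  by split; [|apply/ltW| |]; near: u; [exact: near_mdist_lt|exact: near_mdist_lt|
    exact: near_rho_lt|exact: near_rho_lt].
exists s => // g u g1 /sP[ue uA u2 uc].
have xx : d x x <= A by rewrite mdistxx ltW.
have [w1 /ltW w1A w1u] := delta_onto e1 ue.
have nge : nu (g * e)%g <= nu e by rewrite nuM ler_piMl// ltW.
(* Injectivity of [delta e x] needs [delta g x u] in [U x] before its distance to [x] is known;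
   writing [u = delta e x w1] places it in the range of the dilatation by [g * e]. *)
have Ugu : U x (delta g x u).
  apply: (dilV_dilU (le_lt_trans nge e1)); rewrite -w1u delta_strong//.
  by apply: delta_dilV; [exact: le_trans le1|exact: cball_dilU].
(* The bound [1/2] on [rho x x u] and the error [1/4] leave a factor [3/4 < 1], so the point lies in
   the range of [delta e x]. *)
have [w wA wu] : exists2 w, d x w < A & delta e x w = delta (e * g)%g x u.
  have /andP[_ geu] : nu (e * g)%g * (rho x x u - 4^-1)
      <= d x (delta (e * g)%g x u) <= nu (e * g)%g * (rho x x u + 4^-1).
    by apply: bP => //; rewrite mulgC; exact: le_lt_trans eb.
  apply: delta_onto => //; apply: le_lt_trans geu _.
  rewrite mulgC; apply: le_lt_trans (_ : nu e * 4^-1 * 3 < _).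
    have := rho_ge0 xx uA; have := nu_gt0 (g * e)%g; nra.
  by have := nu_gt0 e; lra.
have guw : delta g x u = w.
  by apply: (delta_inj le1 Ugu (cball_dilU (ltW wA))); rewrite delta_strong.
apply: cP; first by rewrite guw ltW.
have := rho_scale g1 xx uA; rewrite delta_fix => -> //; last by rewrite guw ltW.
by apply: le_lt_trans uc; rewrite ler_piMl// rho_ge0.
Unshelve. all: by end_near. Qed.

(** If [g] expands, a point [u] near [x] is [delta g^-1 x w], and strong A2 applies to the
    contractions [j * g] and [g^-1]. *)
Lemma delta_comp_le j g x : nu j <= 1 -> nu (j * g)%g <= 1 ->
  \forall u \near x, delta j x (delta g x u) = delta (j * g)%g x u.
Proof.
move=> j1 jg1; have [g1|g1] := leP (nu g) 1.
  by near=> u; rewrite delta_strong//; apply: ltW; near: u; exact: near_mdist_lt.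
have gV1 : nu g^-1%g < 1 by rewrite nuV invf_lt1.
near=> u.
have [|w /ltW wA <-] := @delta_onto _ x u gV1.
  by near: u; exact: near_mdist_lt.
rewrite (@delta_strong (j * g)%g)// 1?ltW// mulgK -{1}[g]invgK delta_cancel//.
  exact: ltW.
exact: cball_dilU.
Unshelve. all: by end_near. Qed.

(** Both sides are compared after an injective contraction [delta j x], with [j] so small that
    [j * g] and [j * g * h] contract as well. *)
Lemma delta_comp g h x :
  \forall u \near x, delta g x (delta h x u) = delta (g * h)%g x u.
Proof.
have [|j + /ltW j1] := @scale_lt_ex (Num.min (1 / nu g) (1 / nu (g * h)%g)).
  by rewrite lt_min !divr_gt0.
rewrite lt_min !ltr_pdivlMr// -!nuM mulgA => /andP[/ltW jg1 /ltW jgh1].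
have comp_h := @delta_cvg_center h x.
near=> u; have u1 : d x u < 1 by near: u; exact: near_mdist_lt.
have ghA : d x (delta g x (delta h x u)) <= A.
  apply: ltW; near: u; apply: (cvg_near_ball _ (y := x)); last by rewrite mdistxx.
  exact: cvg_comp comp_h (@delta_cvg_center g x).
have gh'A : d x (delta (g * h)%g x u) <= A.
  apply: ltW; near: u; apply: (cvg_near_ball (@delta_cvg_center _ _)).
  by rewrite mdistxx.
apply: (delta_inj j1 (cball_dilU ghA) (cball_dilU gh'A)).
have -> : delta j x (delta g x (delta h x u)) = delta (j * g)%g x (delta h x u).
  by near: u; exact: comp_h _ (delta_comp_le x j1 jg1).
have -> : delta (j * g)%g x (delta h x u) = delta (j * g * h)%g x u.
  by near: u; exact: delta_comp_le.
rewrite -mulgA; apply/esym; near: u; apply: delta_comp_le => //.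
by rewrite mulgA.
Unshelve. all: by end_near. Qed.

Lemma delta_invK h x : \forall w \near x, delta h x (delta h^-1%g x w) = w.
Proof.
near=> w; have -> : delta h x (delta h^-1%g x w) = delta (h * h^-1)%g x w.
  by near: w; exact: delta_comp.
rewrite mulgV (A1_id HA1)//; apply: cball_dilU; apply: ltW.
by near: w; exact: near_mdist_lt.
Unshelve. all: by end_near. Qed.

(** * The difference function and its limit *)

Lemma near_pair_mdist x (P : X * X -> Prop) :
  (exists2 c : R, 0 < c & forall u v, d x u < c -> d x v < c -> P (u, v)) ->
  \forall p \near (x, x), P p.
Proof.
move=> [c c0 cP]; exists ([set u | d x u < c], [set u | d x u < c]).
  by split; exact: near_mdist_lt.
by move=> [u v] [/= xu xv]; exact: cP.
Qed.

Lemma near_box (x : X) (P : X -> X -> X -> Prop) :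
  (\forall p \near (x, x, x), P p.1.1 p.1.2 p.2) ->
  exists2 s : R, 0 < s &
    forall y u v, d x y < s -> d x u < s -> d x v < s -> P y u v.
Proof.
move=> [[Q1 Q2] /= [[[Q3 Q4] /= [nQ3 nQ4] Q34] nQ2] QP].
have /near_mdistP[s s0 sP] : \forall u \near x, (Q3 u /\ Q4 u) /\ Q2 u.
  exact: filterI (filterI nQ3 nQ4) nQ2.
exists s => // y u v /sP[[Q3y _] _] /sP[[_ Q4u] _] /sP[_ Q2v].
by apply: (QP (y, u, v)); split=> //=; exact: (Q34 (y, u)).
Qed.

Lemma delta_close x (t : R) : 0 < t -> exists2 s : R, 0 < s &
  forall e y u v, nu e < s -> d x y < s -> d x u < s -> d x v < s ->
    d (delta e y u) (delta e y v) < nu e * t.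
Proof.
move=> t0; have [r xr] := good_radius_ex x; have [r0 _ _] := xr.
pose B := filter_prod (at0 nu) (nbhs (x, x, x)).
have xx : d x x < r by rewrite mdistxx.
have cB : (fun q : G * (X * X * X) => q.2) @ B --> (x, x, x) by exact: cvg_snd.
have lim : (nu q.1)^-1 * d (delta q.1 q.2.1.1 q.2.1.2) (delta q.1 q.2.1.1 q.2.2)
    @[q --> B] --> rho x x x.
  apply: (rho_eps_joint xr) => //; first exact: cvg_fst.
  - exact: cvg_comp cB (cvg_comp _ _ cvg_fst cvg_fst).
  - exact: cvg_comp cB (cvg_comp _ _ cvg_fst cvg_snd).
  - exact: cvg_comp cB cvg_snd.
rewrite rhoxx ?mdistxx ?ltW// in lim.
have [[P Q] /= [[b /= b0 bP] nQ] PQ] := cvgr_lt _ lim _ t0.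
have [|s s0 sQ] := @near_box x (fun y u v => Q (y, u, v)).
  by apply: filterS nQ => -[[]].
exists (Num.min b s) => [|e y u v]; first by rewrite lt_min b0.
rewrite !lt_min => /andP[eb _] /andP[_ ys] /andP[_ us] /andP[_ vs].
have := PQ (e, (y, u, v)) (conj (bP _ eb) (sQ _ _ _ ys us vs)).
by rewrite /= ltr_pdivrMl.
Qed.

(* The last condition puts [delta e y v] in the image of the dilatation of
   coefficient [e] centred at [delta e y u]. *)
Definition diff_radius x (s : R) := [/\ 0 < s, s <= 2^-1 &
  forall e y u v, nu e < s -> d x y < s -> d x u < s -> d x v < s ->
    d (delta e y u) (delta e y v) < nu e].

Lemma ball_cball_A x (s : R) y u : s <= 2^-1 -> d x y < s -> d x u < s ->
  d y u <= A.
Proof.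
move=> s2 xy xu.
have := metric_triangle y x u; rewrite (metric_sym y x); move: A_gt1; lra.
Qed.

Section DiffRadius.
Context (x : X) (s : R) (xs : diff_radius x s).

Lemma diff_epsK e y u v : nu e < s -> d x y < s -> d x u < s -> d x v < s ->
  [/\ d (delta e y u) (diff_eps D e y u v) < A,
      delta e (delta e y u) (diff_eps D e y u v) = delta e y v &
      dil_dom nu D e^-1%g (delta e y u) (delta e y v)].
Proof.
have [s0 s2 sP] := xs; move=> es xy xu xv.
have e1 : nu e < 1 by lra.
have [w wA we] := delta_onto e1 (sP _ _ _ _ es xy xu xv).
have Uw : U (delta e y u) w by apply: cball_dilU; exact: ltW.
rewrite /diff_eps -we delta_cancel ?(ltW e1)//; split=> //.
exact: dil_domV.
Qed.

Lemma diff_eps_cvg {J} {B : set_system J} {FB : Filter B} e (y u v : J -> X)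
    y0 u0 v0 : nu e < s -> d x y0 < s -> d x u0 < s -> d x v0 < s ->
  y @ B --> y0 -> u @ B --> u0 -> v @ B --> v0 ->
  diff_eps D e (y j) (u j) (v j) @[j --> B] --> diff_eps D e y0 u0 v0.
Proof.
have [s0 s2 sP] := xs; move=> es xy xu xv yy uu vv.
have e1 : nu e <= 1 by lra.
have dcvg (w : J -> X) w0 : d x w0 < s -> w @ B --> w0 ->
    delta e (y j) (w j) @[j --> B] --> delta e y0 w0.
  move=> xw ww; apply: delta_cvg => //; first exact: cvg_cst.
    by apply: dom_deltaE => //; apply: cball_dilU; exact: ball_cball_A s2 xy xw.
  apply: filterS2 (cvg_near_ball yy xy) (cvg_near_ball ww xw) => j xyj xwj.
  by apply: dom_deltaE => //; apply: cball_dilU; exact: ball_cball_A s2 xyj xwj.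
apply: delta_cvg; [exact: cvg_cst|exact: dcvg|exact: dcvg| |].
  by have [] := diff_epsK es xy xu xv.
apply: filterS3 (cvg_near_ball yy xy) (cvg_near_ball uu xu)
  (cvg_near_ball vv xv) => j xyj xuj xvj.
by have [] := diff_epsK es xyj xuj xvj.
Qed.

End DiffRadius.

(** * The limit [Delta] of the differences and its identities *)

Section TangentDifference.
Context (Delta : X -> X -> X -> X).
Hypothesis HDelta : forall (K : set X) (C : set (X * X * X)),
  compact K -> compact C ->
  C `<=` [set p | [/\ K p.1.1, cball p.1.1 (dilR D K) p.1.2
                    & cball p.1.1 (dilR D K) p.2]] ->
  forall r : R, 0 < r ->
  \forall e \near at0 nu, forall x u v, C (x, u, v) ->
    mdist (diff_eps D e x u v) (Delta x u v) <= r.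

(** A ball on which differences cancel, d and d^x are comparable, and the convergence in A4 is
    uniform for a variable base point too. *)
Definition tangent_radius x (s : R) := [/\ diff_radius x s, good_radius x s &
  forall a : R, 0 < a -> \forall e \near at0 nu, forall y u v,
    d x y <= s -> d x u <= s -> d x v <= s ->
    d (diff_eps D e y u v) (Delta y u v) <= a].

Lemma tangent_radius_ex x : exists s, tangent_radius x s.
Proof.
have [r [r0 r1 cr]] := good_radius_ex x; have [RK0 _ _] := A0_local HA0 cr.
have [b b0 bP] := delta_close x ltr01.
(* Half of [R(K)]: A4 asks [u] and [v] to be within [R(K)] of the base point [y], which may lie at
   distance [s + s] from them. *)
pose s := Num.min (Num.min r (dilR D (cball x r) / 2)) b.
have s0 : 0 < s by rewrite /s !lt_min r0 b0 divr_gt0.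
have [/andP[sr sR] sb] : (s <= r) && (s <= dilR D (cball x r) / 2) /\ s <= b.
  by apply/andP; rewrite -!le_min lexx.
have cs := compact_cballW sr cr.
exists s; split; first split=> //; first lra.
- move=> e y u v es ys us vs; rewrite -[nu e]mulr1.
  by apply: bP; exact: lt_le_trans sb.
- by split=> //; lra.
move=> a a0; have cC := compact_setX (compact_setX cs cs) cs.
have sub : cball x s `*` cball x s `*` cball x s `<=` [set p |
    [/\ cball x r p.1.1, cball p.1.1 (dilR D (cball x r)) p.1.2
      & cball p.1.1 (dilR D (cball x r)) p.2]].
  move=> [[y u] v] [[]]; rewrite /cball/= => xy xu xv.
  have := metric_triangle y x v; have := metric_triangle y x u.
  by rewrite (metric_sym y x); split; lra.
by apply: filterS (HDelta cr cC sub a0) => e eC y u v xy xu xv; exact: eC.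
Qed.

Section TangentRadius.
Context (x : X) (s : R) (xs : tangent_radius x s).
Local Notation Dx := (Delta x).

Let xds : diff_radius x s. Proof. by have [] := xs. Qed.
Let s_gt0 : 0 < s. Proof. by have [] := xds. Qed.
Let xx0 : d x x < s. Proof. by rewrite mdistxx. Qed.

Let box : set (X * X * X) :=
  [set p | [/\ d x p.1.1 < s, d x p.1.2 < s & d x p.2 < s]].

Let diff_eps_unif (a : R) : 0 < a ->
  \forall e \near at0 nu, forall p, box p ->
    ball (Delta p.1.1 p.1.2 p.2) a (diff_eps D e p.1.1 p.1.2 p.2).
Proof.
move=> a0; have [_ _ unif] := xs; have a20 : 0 < a / 2 by rewrite divr_gt0.
apply: filterS (unif _ a20) => e eP p [/ltW p1 /ltW p2 /ltW p3].
by rewrite ballEmdist/= metric_sym; have := eP _ _ _ p1 p2 p3; lra.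
Qed.

Let diff_eps_cont p : box p -> \forall e \near at0 nu,
  diff_eps D e t.1.1 t.1.2 t.2 @[t --> within box (nbhs p)]
    --> diff_eps D e p.1.1 p.1.2 p.2.
Proof.
move=> [p1 p2 p3]; near=> e; apply: (diff_eps_cvg xds) => //.
- by near: e; exact: at0_lt.
- by apply: cvg_within_filter; exact: cvg_comp cvg_fst cvg_fst.
- by apply: cvg_within_filter; exact: cvg_comp cvg_fst cvg_snd.
- by apply: cvg_within_filter; exact: cvg_snd.
Unshelve. all: by end_near. Qed.

Let box_near {J} {B : set_system J} {FB : Filter B} (y u v : J -> X) y0 u0 v0 :
  box (y0, u0, v0) -> y @ B --> y0 -> u @ B --> u0 -> v @ B --> v0 ->
  \forall j \near B, box (y j, u j, v j).
Proof.
move=> [/= xy xu xv] yy uu vv.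
by apply: filterS3 (cvg_near_ball yy xy) (cvg_near_ball uu xu)
  (cvg_near_ball vv xv) => j ? ? ?; split.
Qed.

Lemma diff_eps_joint {J} {B : set_system J} {FB : Filter B} (e : J -> G)
    (y u v : J -> X) y0 u0 v0 :
  d x y0 < s -> d x u0 < s -> d x v0 < s ->
  e @ B --> at0 nu -> y @ B --> y0 -> u @ B --> u0 -> v @ B --> v0 ->
  diff_eps D (e j) (y j) (u j) (v j) @[j --> B] --> Delta y0 u0 v0.
Proof.
move=> xy xu xv e0 yy uu vv; have Sp : box (y0, u0, v0) by split.
apply: (unif_limit_diag diff_eps_unif (diff_eps_cont Sp) Sp e0
  (t := fun j => (y j, u j, v j))).
  exact: cvg_pair (cvg_pair yy uu) vv.
exact: box_near Sp yy uu vv.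
Qed.

Lemma Delta_cvg {J} {B : set_system J} {FB : Filter B} (y u v : J -> X) y0 u0 v0 :
  d x y0 < s -> d x u0 < s -> d x v0 < s ->
  y @ B --> y0 -> u @ B --> u0 -> v @ B --> v0 ->
  Delta (y j) (u j) (v j) @[j --> B] --> Delta y0 u0 v0.
Proof.
move=> xy xu xv yy uu vv; have Sp : box (y0, u0, v0) by split.
apply: (cvg_comp (fun j => (y j, u j, v j)) _ _
  (unif_limit_within diff_eps_unif (diff_eps_cont Sp) Sp)).
have pt := cvg_pair (cvg_pair yy uu) vv.
move=> P /pt; apply: filterS2 (box_near Sp yy uu vv) => j bj.
exact.
Qed.

Lemma diff_eps_lim u v : d x u < s -> d x v < s ->
  diff_eps D e x u v @[e --> at0 nu] --> Dx u v.
Proof.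
by move=> xu xv; apply: diff_eps_joint => //; try exact: cvg_cst; exact: cvg_id.
Qed.

Let near_small : \forall e \near at0 nu, nu e < s /\ nu e < 1.
Proof. by apply: filterI; exact: at0_lt. Qed.

Lemma Delta_xl v : d x v < s -> Dx x v = v.
Proof.
move=> xv; apply: (cvg_unique (@metric_hausdorff _ X) (diff_eps_lim xx0 xv)).
apply: cvg_near_cst; apply: filterS (at0_le ltr01) => e e1.
rewrite /diff_eps delta_fix delta_cancel//; apply: cball_dilU.
by have [_ s2 _] := xds; apply: ball_cball_A s2 xx0 xv.
Qed.

Lemma Delta_diag u : d x u < s -> Dx u u = x.
Proof.
move=> xu; apply: (cvg_unique (@metric_hausdorff _ X) (diff_eps_lim xu xu)).
have Uu : U x u.
  by have [_ s2 _] := xds; apply: cball_dilU; exact: ball_cball_A s2 xx0 xu.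
apply: cvg_near_eq (A1_lim HA1 Uu); apply: nearW => e.
by rewrite /diff_eps delta_fix.
Qed.

Lemma Delta_small (a : R) : 0 < a -> exists2 b : R, 0 < b &
  forall u v, d x u < b -> d x v < b -> d x (Dx u v) < a.
Proof.
move=> a0; have lim : Delta t.1.1 t.1.2 t.2 @[t --> (x, x, x)] --> Dx x x.
  apply: Delta_cvg => //.
  - exact: cvg_comp cvg_fst cvg_fst.
  - exact: cvg_comp cvg_fst cvg_snd.
  - exact: cvg_snd.
rewrite (Delta_diag xx0) in lim.
have [|b b0 bP] := @near_box x (fun y u v => d x (Delta y u v) < a).
  by apply: cvg_near_ball lim _; rewrite mdistxx.
by exists b => // u v; apply: bP; rewrite mdistxx.
Qed.

Lemma delta_to_x u : d x u < s -> delta e x u @[e --> at0 nu] --> x.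
Proof.
move=> xu; have [_ s2 _] := xds; apply: (A1_lim HA1); apply: cball_dilU.
exact: ball_cball_A s2 xx0 xu.
Qed.

(** At the centre [y = delta e x u], dilating the two differences by [e] gives back [delta e x v]
    and [delta e x w], so the rescaled distances agree for small [e]. As [y] moves with [e], the
    limit must be joint. *)
Lemma Delta_isometry u v w : d x u < s -> d x v < s -> d x w < s ->
  d x (Dx u v) < s -> d x (Dx u w) < s ->
  rho x (Dx u v) (Dx u w) = rho x v w.
Proof.
move=> xu xv xw xuv xuw; have [_ xr _] := xs.
have A_of z : d x z < s -> d x z <= A.
  by move=> xz; apply: (good_radius_center xr); exact: ltW.
apply/esym; apply: (cvg_unique (@Rhausdorff R) (rho_cvg (A_of _ xv) (A_of _ xw))).
have lim := rho_eps_joint xr xx0 xuv xuw cvg_id (delta_to_x xu)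
  (diff_eps_lim xu xv) (diff_eps_lim xu xw).
apply: cvg_near_eq (lim _); apply: filterS near_small => e [es e1].
have [_ -> _] := diff_epsK xds es xx0 xu xv.
by have [_ -> _] := diff_epsK xds es xx0 xu xw.
Qed.

(** At the centre [y = delta e x u], the difference of Delta_e(u, v) and Delta_e(u, w) is exactly
    Delta_e(v, w), since their dilates are [delta e x v] and [delta e x w]. *)
Lemma Delta_assoc u v w : d x u < s -> d x v < s -> d x w < s ->
  d x (Dx u v) < s -> d x (Dx u w) < s -> Dx (Dx u v) (Dx u w) = Dx v w.
Proof.
move=> xu xv xw xuv xuw.
have lim := diff_eps_joint xx0 xuv xuw cvg_id (delta_to_x xu)
  (diff_eps_lim xu xv) (diff_eps_lim xu xw).
apply: (cvg_unique (@metric_hausdorff _ X) (lim _)).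
apply: cvg_near_eq (diff_eps_lim xv xw).
apply: filterS near_small => e [es _]; rewrite [RHS]/diff_eps.
have [_ -> _] := diff_epsK xds es xx0 xu xv.
by have [_ -> _] := diff_epsK xds es xx0 xu xw.
Qed.

(** Let [y] be the dilatation of [u] by [e * m] and [a] the difference of [u], [v] at [e * m]. The
    difference at [e] of the dilated points is [delta e^-1 y] of the dilatation of [a] by [e * m]
    about [y]; strong A2 at centre [y] reduces it to [delta m y a]. *)
Lemma Delta_morph m u v : nu m <= 1 -> d x u < s -> d x v < s ->
  d x (delta m x u) < s -> d x (delta m x v) < s -> d x (Dx u v) < s ->
  d x (delta m x (Dx u v)) < A ->
  Dx (delta m x u) (delta m x v) = delta m x (Dx u v).
Proof.
move=> m1 xu xv xmu xmv xuv xmuv; have [_ s2 _] := xds.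
have A_of z : d x z < s -> d x z <= A := ball_cball_A s2 xx0.
pose y e := delta (e * m)%g x u; pose a e := diff_eps D (e * m)%g x u v.
have yx : y @ at0 nu --> x := cvg_comp _ _ (at0_mulg Hnu m) (delta_to_x xu).
have aD : a @ at0 nu --> Dx u v.
  exact: cvg_comp (at0_mulg Hnu m) (diff_eps_lim xu xv).
have dom_a : \forall e \near at0 nu, d (y e) (a e) <= A.
  apply: filterS2 (cvg_near_ball yx xx0) (cvg_near_ball aD xuv) => e xy xa.
  exact: ball_cball_A s2 xy xa.
have lim : delta m (y e) (a e) @[e --> at0 nu] --> delta m x (Dx u v).
  apply: delta_cvg => //; first exact: cvg_cst.
    by apply: dom_deltaE => //; apply: cball_dilU; exact: A_of.
  by apply: filterS dom_a => e ya; apply: dom_deltaE => //; exact: cball_dilU.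
apply: (cvg_unique (@metric_hausdorff _ X) _ lim).
apply: cvg_near_eq (diff_eps_lim xmu xmv); near=> e.
have [es e1] : nu e < s /\ nu e < 1 by near: e.
have ems : nu (e * m)%g < s.
  by apply: le_lt_trans es; rewrite nuM ler_piMr// ltW.
have Uma : d (y e) (delta m (y e) (a e)) < A.
  by near: e; apply: cvgr_lt (cvg_mdist yx lim) _ xmuv.
have ya : d (y e) (a e) <= A by near: e.
rewrite /diff_eps (delta_strong (ltW e1) m1 (A_of _ xu)).
rewrite (delta_strong (ltW e1) m1 (A_of _ xv)).
have [_ <- _] := diff_epsK xds ems xx0 xu xv.
rewrite -/(y e) -/(a e) -(delta_strong (ltW e1) m1 ya) delta_cancel ?(ltW e1)//.
by apply: cball_dilU; exact: ltW.
Unshelve. all: by end_near. Qed.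

(* No local surjectivity of [Delta x u] is needed: a cluster point [w] of the
   sums satisfies [Delta x u w = v], and [Delta x u] is an isometry. *)
Lemma sum_cvg (a : R) : 0 < a -> a <= s -> exists2 b : R, 0 < b &
  forall u v, d x u < b -> d x v < b ->
    (\forall e \near at0 nu, sum_defined nu D e x u v) /\
    exists w, [/\ d x w < a, Dx u w = v &
      sum_eps D e x u v @[e --> at0 nu] --> w].
Proof.
move=> a0 as_; have [_ xr unif] := xs; have [_ s2 _] := xds.
have [_ _ cs] := xr.
have A_of z : d x z < s -> d x z <= A := ball_cball_A s2 xx0.
have a20 : 0 < a / 2 by rewrite divr_gt0.
have [t t0 tP] := rho_control x a20.
(* The point [z] below is within [nu e * (p + p)] of [x]: [p <= 1/4] puts it in the range of
   [delta e x], and A3 with error [p] bounds [rho x x w] for its preimage [w] by [3p < t]. *)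
have p0 : 0 < Num.min t 1 / 4 by rewrite divr_gt0// lt_min t0 ltr01.
set p := Num.min t 1 / 4 in p0.
have [pt p1] : p <= t / 4 /\ p <= 1 / 4.
  by split; rewrite ler_pM2r ?invr_gt0// ge_min lexx ?orbT.
have [c c0 cP] := delta_close x p0.
have [q q0 qP] := A3_center x p0.
pose b := Num.min s c; exists b => [|u v]; first by rewrite lt_min s_gt0.
rewrite !lt_min => /andP[xu xuc] /andP[xv xvc].
have near_y (h : R) : 0 < h -> \forall e \near at0 nu, d x (delta e x u) < h.
  by move=> h0; apply: cvg_near_ball (delta_to_x xu) _; rewrite mdistxx.
have sums : \forall e \near at0 nu, sum_defined nu D e x u v /\
    exists w, [/\ d x w < a / 2, sum_eps D e x u v = w &
      diff_eps D e x u w = v].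
  near=> e.
  have e1 : nu e < 1 by near: e; exact: at0_lt.
  have ec : nu e < c by near: e; exact: at0_lt.
  have e_q : nu e < q by near: e; exact: at0_lt.
  have xys : d x (delta e x u) < s by near: e; exact: near_y.
  have xyc : d x (delta e x u) < c by near: e; exact: near_y.
  pose y := delta e x u; pose z := delta e y v.
  have xy : d x y < nu e * p.
    by have := cP e x x u ec; rewrite mdistxx delta_fix; exact.
  have yz : d y z < nu e * p.
    by have := cP e y y v ec xyc xyc xvc; rewrite delta_fix.
  have xz : d x z < nu e * (p + p).
    by rewrite mulrDr; apply: le_lt_trans (metric_triangle x y z) _; lra.
  have Uyv : U y v by apply: cball_dilU; exact: ball_cball_A s2 xys xv.
  have [|w wA wz] := @delta_onto e x z e1.
    by apply: (lt_le_trans xz); rewrite ler_piMr ?ltW//; lra.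
  have Uxw : U x w by apply: cball_dilU; exact: ltW.
  have sumE : sum_eps D e x u v = w.
    by rewrite /sum_eps -/y -/z -wz delta_cancel// ltW.
  split.
    split; rewrite -/y -/z ?/dil_dom ?(ltW e1)//.
      by apply: cball_dilU; exact: A_of.
    by rewrite -wz; exact: dil_domV.
  exists w; split=> //.
    apply: tP; first exact: ltW.
    have /andP[+ _] := qP e w e_q (ltW wA).
    rewrite wz => /le_lt_trans/(_ xz); rewrite ltr_pM2l//; lra.
  by rewrite /diff_eps wz -/y delta_cancel// ltW.
split; first by apply: filterS sums => e [].
pose w_ e := sum_eps D e x u v.
have w_le : \forall e \near at0 nu, d x (w_ e) < a / 2.
  by apply: filterS sums => e [_ [w [xw wE _]]]; rewrite /w_ wE.
have diff_w : \forall e \near at0 nu, diff_eps D e x u (w_ e) = v.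
  by apply: filterS sums => e [_ [w [_ wE]]]; rewrite /w_ wE.
(* Since [w_ e] varies with [e], replacing Delta_e by its limit relies on uniform convergence. *)
have Dw : Dx u (w_ e) @[e --> at0 nu] --> v.
  apply/cvg_mdistP => h h0; have h20 : 0 < h / 2 by rewrite divr_gt0.
  apply: filterS3 (unif _ h20) w_le diff_w => e eP we <-.
  have := eP x u (w_ e); rewrite mdistxx => /(_ (ltW s_gt0) (ltW xu)).
  by move=> /(_ ltac:(lra)); lra.
have a2s : a / 2 <= s by lra.
have [|w [xw clw]] := compact_cballW a2s cs (F := w_ @ at0 nu).
  by apply: filterS w_le => e /ltW.
have xw_a : d x w < a by move: xw; rewrite /cball/=; lra.
have xw_s : d x w < s by lra.
have Dw_cont : Dx u w' @[w' --> w] --> Dx u w.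
  by apply: Delta_cvg => //; try exact: cvg_cst; exact: cvg_id.
have Duw : Dx u w = v.
  apply: mdist_positivity; apply/eqP; rewrite eq_le mdist_ge0 andbT.
  apply/ler_addgt0Pl => h h0; rewrite addr0.
  have h20 : 0 < h / 2 by rewrite divr_gt0.
  have Pw : (w_ @ at0 nu) [set w' | d v (Dx u w') < h / 2].
    by have /cvg_mdistP/(_ _ h20) := Dw.
  have Qw : nbhs w [set w' | d (Dx u w) (Dx u w') < h / 2].
    by have /cvg_mdistP/(_ _ h20) := Dw_cont.
  have [w' [/= vw' ww']] := clw _ _ Pw Qw.
  have := metric_triangle (Dx u w) (Dx u w') v.
  by rewrite (metric_sym (Dx u w') v); lra.
(* The d^x-distance from [w] to [w_ e] is that from [v] to [Dx u (w_ e)], which tends to 0: the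
   whole family converges, not only along the cluster point. *)
exists w; split=> //; apply/cvg_mdistP => h h0.
have [k k0 kP] := mdist_modulus xr h0; have [l l0 lP] := rho_modulus xr k0.
near=> e; have we : d x (w_ e) < a / 2 by near: e.
have wes : d x (w_ e) < s by lra.
have Dws : d x (Dx u (w_ e)) < s by near: e; exact: cvg_near_ball Dw xv.
apply: kP; [exact: ltW|exact: ltW|].
rewrite -(Delta_isometry xu xw_s wes) ?Duw//; apply: lP; [exact: ltW|exact: ltW|].
by near: e; have /cvg_mdistP := Dw; exact.
Unshelve. all: by end_near. Qed.

Lemma Delta_modulus (t : R) : t < s -> forall h : R, 0 < h ->
  exists2 k : R, 0 < k & forall u u' w, d x u <= t -> d x u' <= t -> d x w <= t ->
    d u u' < k -> d (Dx u w) (Dx u' w) < h.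
Proof.
move=> ts h h0; have [_ [_ _ cs] _] := xs; have ct := compact_cballW (ltW ts) cs.
pose K : set (X * X * X) := cball x t `*` cball x t `*` cball x t.
have cK : compact K := compact_setX (compact_setX ct ct) ct.
have lt_s z : cball x t z -> d x z < s by move=> /le_lt_trans; exact.
have c1 (p : X * X * X) : t'.1.1 @[t' --> within K (nbhs p)] --> p.1.1.
  by apply: cvg_within_filter; exact: cvg_comp cvg_fst cvg_fst.
have c2 (p : X * X * X) : t'.1.2 @[t' --> within K (nbhs p)] --> p.1.2.
  by apply: cvg_within_filter; exact: cvg_comp cvg_fst cvg_snd.
have c3 (p : X * X * X) : t'.2 @[t' --> within K (nbhs p)] --> p.2.
  by apply: cvg_within_filter; exact: cvg_snd.
have [|p [[/lt_s xu /lt_s xu'] /lt_s xw]|p _|p _ uu'|k k0 kP] :=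
    @compact_modulus R _ _ (fun p => d p.1.1 p.1.2)
      (fun p => d (Dx p.1.1 p.2) (Dx p.1.2 p.2)) cK _ _ _ _ h h0.
- by move=> p _; exact: cvg_mdist (c1 p) (c2 p).
- by apply: cvg_mdist; apply: Delta_cvg => //; exact: cvg_cst.
- exact: mdist_ge0.
- by rewrite (mdist_positivity _ _ uu') mdistxx.
- by exists k => // u u' w xu xu' xw; apply: (kP (u, u', w)); split.
Qed.

(** * The limit operation and the radii that control it *)

Local Notation Sg := (sum_lim nu D x).

Lemma sum_limE u v w : sum_eps D e x u v @[e --> at0 nu] --> w -> Sg u v = w.
Proof.
move=> lim; apply: (cvg_unique (@metric_hausdorff _ X) _ lim).
by apply: (@xgetPex _ x [set l | _ @[e --> at0 nu] --> l]); exists w.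
Qed.

(** Three scales: summands within [b], sums within [t], and differences of points within [t] stay
    within [s], where the identities for [Delta] hold. *)
Definition group_radius (t b : R) := [/\ 0 < b, b <= t, t < s,
  forall u v, d x u < t -> d x v < t -> d x (Dx u v) < s &
  forall u v, d x u < b -> d x v < b ->
    [/\ \forall e \near at0 nu, sum_defined nu D e x u v,
        sum_eps D e x u v @[e --> at0 nu] --> Sg u v,
        d x (Sg u v) < t & Dx u (Sg u v) = v]].

Lemma sum_small (a : R) : 0 < a -> exists2 b : R, 0 < b &
  forall u v, d x u < b -> d x v < b ->
    [/\ \forall e \near at0 nu, sum_defined nu D e x u v,
        sum_eps D e x u v @[e --> at0 nu] --> Sg u v,
        d x (Sg u v) < a & Dx u (Sg u v) = v].
Proof.
move=> a0; have [||b b0 bP] := @sum_cvg (Num.min a s).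
- by rewrite lt_min a0.
- by rewrite ge_min lexx orbT.
exists b => // u v xu xv; have [sd [w [+ uw lim]]] := bP u v xu xv.
by rewrite lt_min (sum_limE lim) => /andP[].
Qed.

Lemma group_radius_ex : exists t b, group_radius t b.
Proof.
have [t' t'0 t'P] := Delta_small s_gt0.
pose t := Num.min t' (s / 2); have t0 : 0 < t by rewrite lt_min t'0 divr_gt0.
have [tt' ts] : t <= t' /\ t <= s / 2 by split; rewrite ge_min lexx ?orbT.
have [b b0 bP] := sum_small t0.
exists t, (Num.min b t); split; first by rewrite lt_min b0.
- by rewrite ge_min lexx orbT.
- by move: s_gt0; lra.
- by move=> u v xu xv; apply: t'P; exact: lt_le_trans tt'.
- have minb : Num.min b t <= b by rewrite ge_min lexx.
  by move=> u v xu xv; apply: bP; exact: lt_le_trans minb.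
Qed.

(** * The local group *)

Section GroupRadius.
Context (t b : R) (tb : group_radius t b).
Let b_gt0 : 0 < b. Proof. by have [] := tb. Qed.
Let b_le : b <= t. Proof. by have [] := tb. Qed.
Let t_lt : t < s. Proof. by have [] := tb. Qed.
Let xxb : d x x < b. Proof. by rewrite mdistxx. Qed.
Let bt z : d x z < b -> d x z < t. Proof. by move=> /lt_le_trans; exact. Qed.
Let ts z : d x z < t -> d x z < s. Proof. by move=> /lt_trans; exact. Qed.
Let Dt u v : d x u < t -> d x v < t -> d x (Dx u v) < s.
Proof. by have [_ _ _ + _] := tb; exact. Qed.
Let sumP u v (xu : d x u < b) (xv : d x v < b) :
  d x (Sg u v) < t /\ Dx u (Sg u v) = v.
Proof. by have [_ _ _ _ /(_ u v xu xv)[]] := tb. Qed.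

Lemma Delta_rho u v w : d x u < t -> d x v < t -> d x w < t ->
  rho x (Dx u v) (Dx u w) = rho x v w.
Proof. by move=> xu xv xw; apply: Delta_isometry; rewrite ?Dt// ts. Qed.

(** An isometry of the non-degenerate d^x is injective. Each group law thereby reduces to an
    identity for [Delta]. *)
Lemma sum_unique u v w : d x u < b -> d x v < b -> d x w < t -> Dx u w = v ->
  Sg u v = w.
Proof.
move=> xu xv xw uw; have [xuv uuv] := sumP xu xv; have [_ xr _] := xs.
have tA z : d x z < t -> d x z <= A.
  by move=> /ts /ltW; exact: (good_radius_center xr).
apply: (A3_nondegenerate HA3 (tA _ xuv) (tA _ xw)).
rewrite -(Delta_rho (bt xu) xuv xw) uuv uw rhoxx//.
exact/tA/bt.
Qed.

Lemma sum_rho u v w : d x u < b -> d x v < b -> d x w < b ->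
  rho x (Sg u v) (Sg u w) = rho x v w.
Proof.
move=> xu xv xw; have [xuv uuv] := sumP xu xv; have [xuw uuw] := sumP xu xw.
by rewrite -(Delta_rho (bt xu) xuv xuw) uuv uuw.
Qed.

Lemma sum_xl v : d x v < b -> Sg x v = v.
Proof.
by move=> xv; apply: sum_unique => //; [exact: bt|exact/Delta_xl/ts/bt].
Qed.

Lemma sum_xr u : d x u < b -> Sg u x = u.
Proof.
by move=> xu; apply: sum_unique => //; [exact: bt|exact/Delta_diag/ts/bt].
Qed.

Lemma sum_invr u : d x u < b -> d x (Dx u x) < b -> Sg u (Dx u x) = x.
Proof. by move=> xu xiu; apply: sum_unique => //; exact: bt. Qed.

(** What is needed is Delta(Delta(u, x), x) = u: the composition law, once the last [x] is written
    Delta(u, u). *)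
Lemma sum_invl u : d x u < b -> d x (Dx u x) < b -> Sg (Dx u x) u = x.
Proof.
move=> xu xiu; apply: sum_unique => //; first exact: bt.
have xus := ts (bt xu); have uu := Delta_diag xus.
by have := Delta_assoc xus xx0 xus (ts (bt xiu)); rewrite uu Delta_xl// => ->.
Qed.

(** Additively, let p = u + v and q = p + w. Then Delta(v, Delta(u, q)) = Delta(Delta(u, p),
    Delta(u, q)) = Delta(p, q) = w, so Delta(u, q) = v + w, which says q = u + (v + w). *)
Lemma sum_assoc : exists2 c : R, 0 < c & forall u v w,
  d x u < c -> d x v < c -> d x w < c ->
  [/\ d x (Sg u v) < b, d x (Sg v w) < b & Sg (Sg u v) w = Sg u (Sg v w)].
Proof.
have t_gt0 : 0 < t := lt_le_trans b_gt0 b_le.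
have [a a0 aP] := Delta_small t_gt0.
have [|c1 c10 c1P] := @sum_small (Num.min a t); first by rewrite lt_min a0.
have [|c2 c20 c2P] := @sum_small (Num.min c1 b); first by rewrite lt_min c10.
exists (Num.min (Num.min c1 c2) (Num.min a b)) => [|u v w].
  by rewrite !lt_min c10 c20 a0.
rewrite !lt_min => /andP[/andP[u1 u2] /andP[ua ub]].
move=> /andP[/andP[v1 v2] /andP[va vb]] /andP[/andP[w1 w2] /andP[wa wb]].
have [_ _ + Dup] := c2P u v u2 v2; set p := Sg u v in Dup *.
rewrite lt_min => /andP[p1 pb].
have [_ _ + _] := c2P v w v2 w2; rewrite lt_min => /andP[_ vwb].
have [_ _ + Dpq] := c1P p w p1 w1; set q := Sg p w in Dpq *.
rewrite lt_min => /andP[qa qt].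
have vwE : Sg v w = Dx u q.
  apply: sum_unique => //; first exact: aP.
  have [xu xp xq] := And3 (ts (bt ub)) (ts (bt pb)) (ts qt).
  rewrite -{1}Dup Delta_assoc ?Dpq// ?Dup; first exact/ts/bt.
  by apply: Dt => //; exact: bt.
by split=> //; apply/esym; apply: sum_unique => //; rewrite vwE.
Qed.

(** The triangle goes through [Sg u' v]. Translation by [u'] is an isometry, which settles the leg
    from [v] to [v']; applying [Dx u'] to the other leg compares [Dx u' (Sg u v)] with
    [v = Dx u (Sg u v)], and [Delta] is uniformly continuous. *)
Lemma sum_modulus (h : R) : 0 < h -> exists2 k : R, 0 < k & forall u v u' v',
  d x u < b -> d x v < b -> d x u' < b -> d x v' < b ->
  d u u' < k -> d v v' < k -> d (Sg u v) (Sg u' v') < h.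
Proof.
move=> h0; have [_ xr _] := xs.
have tA z : d x z < t -> d x z <= A.
  by move=> /ts /ltW; exact: (good_radius_center xr).
have [a a0 aP] := mdist_modulus xr h0; have a20 : 0 < a / 2 by rewrite divr_gt0.
have [k k0 kP] := rho_modulus xr a20; have [l l0 lP] := Delta_modulus t_lt k0.
exists (Num.min k l) => [|u v u' v' xu xv xu' xv']; first by rewrite lt_min k0.
rewrite !lt_min => /andP[_ uu'] /andP[vv' _].
have [w1 D1] := sumP xu xv; have [w2 D2] := sumP xu' xv.
have [w3 D3] := sumP xu' xv'.
apply: aP; [exact/ltW/ts|exact/ltW/ts|].
apply: le_lt_trans (rho_triangle (tA _ w1) (tA _ w2) (tA _ w3)) _.
rewrite [ltRHS]splitr ltrD//; last first.
  by rewrite sum_rho//; apply: kP; rewrite ?(ltW (ts (bt _))).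
rewrite -(Delta_rho (bt xu') w1 w2) D2 -[in X in rho x _ X]D1.
have Ds : d x (Dx u' (Sg u v)) <= s by apply: ltW; apply: Dt => //; exact: bt.
apply: kP => //; first by rewrite D1; exact/ltW/ts/bt.
rewrite metric_sym; apply: lP => //; try exact/ltW; exact/ltW/bt.
Qed.

Lemma near_sum (P : X -> Prop) : (\forall w \near x, P w) ->
  \forall p \near (x, x), P (Sg p.1 p.2).
Proof.
move=> /near_mdistP[a a0 aP]; have [c c0 cP] := sum_small a0.
apply: near_pair_mdist; exists c => // u v xu xv; apply: aP.
by have [] := cP u v xu xv.
Qed.

Lemma near_ball2 (a : R) : 0 < a ->
  \forall p \near (x, x), d x p.1 < a /\ d x p.2 < a.
Proof. by move=> a0; apply: near_pair_mdist; exists a. Qed.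

Lemma delta2_cvg g :
  (delta g x p.1, delta g x p.2) @[p --> (x, x)] --> (x, x).
Proof.
apply: cvg_pair.
  exact: cvg_comp cvg_fst (@delta_cvg_center g x).
exact: cvg_comp cvg_snd (@delta_cvg_center g x).
Qed.

(** A contraction is handled by [Delta_morph] and uniqueness. For an expanding [g], the law for
    [g^-1] is used at the dilated points and [delta g x] is applied to the result. *)
Lemma sum_morph g : \forall p \near (x, x),
  delta g x (Sg p.1 p.2) = Sg (delta g x p.1) (delta g x p.2).
Proof.
have small m : nu m <= 1 -> \forall p \near (x, x),
    Sg (delta m x p.1) (delta m x p.2) = delta m x (Sg p.1 p.2).
  move=> m1; have t0 : 0 < t := lt_le_trans b_gt0 b_le.
  have lt_A (z : X) : d x z < b -> d x z < A.
    have [_ s2 _] := xds.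
    move=> /bt /ts xz; apply: lt_trans xz (le_lt_trans s2 _).
    by move: A_gt1; lra.
  near=> p.
  have [xu xv] : d x p.1 < b /\ d x p.2 < b by near: p; exact: near_ball2.
  have [xmu xmv] : d x (delta m x p.1) < b /\ d x (delta m x p.2) < b.
    by near: p; apply: (@delta2_cvg m _ (near_ball2 b_gt0)).
  have xw : d x (Sg p.1 p.2) < t by have [] := sumP xu xv.
  have xmw : d x (delta m x (Sg p.1 p.2)) < t.
    near: p; apply: (@near_sum (fun w => d x (delta m x w) < t)).
    by apply: cvg_near_ball (@delta_cvg_center m x) _; rewrite mdistxx.
  have [_ Dw] := sumP xu xv.
  apply: sum_unique => //.
  have := Delta_morph m1 (ts (bt xu)) (ts xw) (ts (bt xmu)) (ts xmw).
  by rewrite Dw; apply; [exact/ts/bt|exact: lt_A].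
have [g1|g1] := leP (nu g) 1.
  by apply: filterS (small _ g1) => p.
have gV1 : nu g^-1%g <= 1 by rewrite nuV invf_le1// ltW.
have inv2_near h : \forall p \near (x, x), delta h x (delta h^-1%g x p.1) = p.1 /\
    delta h x (delta h^-1%g x p.2) = p.2.
  have /near_mdistP[a a0 aP] := delta_invK h x.
  by apply: near_pair_mdist; exists a => // u v /aP ? /aP.
have gg := @delta2_cvg g.
near=> p.
have morph : Sg (delta g^-1%g x (delta g x p.1)) (delta g^-1%g x (delta g x p.2)) =
    delta g^-1%g x (Sg (delta g x p.1) (delta g x p.2)).
  by near: p; exact: gg _ (small _ gV1).
have [E1 E2] : delta g^-1%g x (delta g x p.1) = p.1 /\
    delta g^-1%g x (delta g x p.2) = p.2.
  by near: p; have := inv2_near g^-1%g; rewrite invgK.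
rewrite E1 E2 in morph; rewrite morph.
by near: p; exact: gg _ (near_sum (delta_invK g x)).
Unshelve. all: by end_near. Qed.

Local Notation M := [set p : X * X | d x p.1 < b /\ d x p.2 < b].

Lemma sum_local_group : local_group (U x) x M Sg.
Proof.
have [_ xr _] := xs.
have A_of z : d x z < b -> d x z <= A.
  by move=> /bt /ts /ltW; exact: (good_radius_center xr).
have nearM : nbhs (x, x) M by exact: near_ball2.
have near_b : \forall u \near x, d x u < b by exact: near_mdist_lt.
have near_inv : \forall u \near x, d x (Dx u x) < b.
  have lim : Delta x u x @[u --> x] --> Dx x x.
    by apply: Delta_cvg => //; try exact: cvg_cst; exact: cvg_id.
  by apply: cvg_near_ball lim _; rewrite Delta_diag.
split.
- by apply/near_mdistP; exists A => // u /ltW; exact: cball_dilU.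
- exact: nearM.
- move=> u v [/= xu xv]; have [xuv _] := sumP xu xv.
  split; apply: cball_dilU; [exact: A_of|exact: A_of|].
  by apply: (good_radius_center xr); exact/ltW/ts.
- near=> u; have xu : d x u < b by near: u.
  by split; [split|exact: sum_xl|split|exact: sum_xr].
- have [c c0 cP] := sum_assoc.
  have cb0 : 0 < Num.min c b by rewrite lt_min c0.
  apply: filterS (_ : nbhs (x, x, x) [set p | [/\ d x p.1.1 < Num.min c b,
      d x p.1.2 < Num.min c b & d x p.2 < Num.min c b]]).
    move=> [[u v] w] /=; rewrite !lt_min.
    move=> [/andP[u1 u2] /andP[v1 v2] /andP[w1 w2]].
    by have [? ? ->] := cP u v w u1 v1 w1.
  have lt_near := near_mdist_lt x cb0.
  near=> p; split; near: p.
  + exact: cvg_comp cvg_fst cvg_fst _ lt_near.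
  + exact: cvg_comp cvg_fst cvg_snd _ lt_near.
  + exact: cvg_snd _ lt_near.
- exists M; first exact: nearM.
  apply: unif_continuous_on_ball => h h0; have [k k0 kP] := sum_modulus h0.
  exists k => // -[u v] [u' v'] [/= xu xv] [/= xu' xv'] [/=].
  by rewrite !ballEmdist /=; exact: kP.
- exists setT; first exact: filterT.
  apply: unif_continuous_on_ball => h h0; exists h => // u v _ _ uv.
  by split=> //=; exact: ballxx.
- exists (Dx^~ x); split; first exact: Delta_diag.
    near=> u; have xu : d x u < b by near: u.
    have xiu : d x (Dx u x) < b by near: u.
    by split; [split|exact: sum_invr|split|exact: sum_invl].
  exists [set u | d x u < b]; first exact: near_b.
  apply: unif_continuous_on_ball => h h0; have [k k0 kP] := Delta_modulus t_lt h0.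
  exists (Num.min k h) => [|u v /= xu xv]; first by rewrite lt_min k0.
  rewrite !ballEmdist /= lt_min => /andP[uvk uvh].
  split=> /=; rewrite ballEmdist//=; apply: kP => //; try exact/ltW/bt.
Unshelve. all: by end_near. Qed.

End GroupRadius.

End TangentRadius.
End TangentDifference.

(** * The action of the dilatations *)

Section Action.
Context (x : X) (r s1 s2 : R) (xr : good_radius x r).
Hypothesis s12 : 0 < s2 /\ s2 <= s1 <= r.
Hypothesis stable1 : forall g u, nu g <= 1 -> d x u < s1 -> d x (delta g x u) < r.
Hypothesis stable2 : forall g u, nu g <= 1 -> d x u < s2 -> d x (delta g x u) < s1.

(* The shrinking factor [nu g] makes the images of [act_dom g] small for
   large [nu g], so that the action is equicontinuous over the whole group. *)
Definition act_dom g : set X := if nu g <= 1 then [set u | d x u < s1] else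
  delta g^-1%g x @` [set w | d x w < s2 /\ nu g * rho x x w < 1].

Let r_A u : d x u < r -> d x u <= A.
Proof. by move=> /ltW; exact: (good_radius_center xr). Qed.

Let s1_r u : d x u < s1 -> d x u < r.
Proof. by have [_ /andP[_]] := s12 => s1r /lt_le_trans; exact. Qed.

Let s2_s1 u : d x u < s2 -> d x u < s1.
Proof. by have [_ /andP[s21 _]] := s12 => /lt_le_trans; exact. Qed.

Let xx : d x x <= A. Proof. by rewrite mdistxx ltW. Qed.

Variant act_dom_spec g u : Prop :=
| ActDomSmall : nu g <= 1 -> d x u < s1 -> act_dom_spec g u
| ActDomLarge w : 1 < nu g -> d x w < s2 -> nu g * rho x x w < 1 ->
    u = delta g^-1%g x w -> delta g x u = w -> act_dom_spec g u.

Lemma act_domP g u : act_dom g u -> act_dom_spec g u.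
Proof.
rewrite /act_dom; have [g1|g1] := leP (nu g) 1; first by constructor.
move=> [w [xw xxw] <-]; apply: (@ActDomLarge g _ w) => //.
rewrite -{1}[g]invgK delta_cancel ?nuV ?invf_le1 ?(ltW g1)//.
exact/cball_dilU/r_A/s1_r/s2_s1.
Qed.

Lemma act_dom_sub g u : act_dom g u -> d x u < s1.
Proof.
move=> /act_domP[//|w g1 xw _ -> _]; apply: stable2 => //.
by rewrite nuV invf_le1 ?(ltW g1).
Qed.

Lemma act_image g u : act_dom g u -> d x (delta g x u) < r.
Proof.
by move=> /act_domP[g1 xu|w g1 xw _ _ ->]; [exact: stable1|exact/s1_r/s2_s1].
Qed.

Lemma act_dom_dil g : act_dom g `<=` dil_dom nu D g x.
Proof.
move=> u /act_domP[g1 xu|w g1 xw _ -> _].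
  by rewrite /dil_dom g1; exact/cball_dilU/r_A/s1_r.
rewrite -{1}[g]invgK; apply: dil_domV; first by rewrite nuV invf_lt1.
exact/cball_dilU/r_A/s1_r/s2_s1.
Qed.

Lemma act_inj g : set_inj (act_dom g) (delta g x).
Proof.
move=> u v; rewrite !inE => /[dup] /act_dom_sub xu /act_domP[g1 _|w g1 _ _ -> ->].
  by move=> /act_dom_sub xv; apply: delta_inj => //; exact/cball_dilU/r_A/s1_r.
by move=> /act_domP[|w' _ _ _ -> -> -> //]; rewrite leNgt g1.
Qed.

(** Valid on all of [act_dom g], not only near [x]: for an expanding [g] the points of the domain
    come as [delta g^-1 x w]. *)
Lemma act_comp j g u : act_dom g u -> nu j <= 1 -> nu (j * g)%g <= 1 ->
  delta j x (delta g x u) = delta (j * g)%g x u.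
Proof.
move=> /act_domP[g1 xu|w g1 xw _ -> ->] j1 jg1.
  by rewrite delta_strong//; exact/r_A/s1_r.
rewrite delta_strong ?mulgK//; last exact/r_A/s1_r/s2_s1.
by rewrite nuV invf_le1 ?(ltW g1).
Qed.

Lemma near_act_dom g : \forall u \near x, act_dom g u.
Proof.
have [s20 /andP[s21 s1r]] := s12; rewrite /act_dom; have [g1|g1] := leP (nu g) 1.
  by apply: near_mdist_lt; exact: lt_le_trans s21.
have near_w : \forall w \near x, d x w < s2 /\ nu g * rho x x w < 1.
  apply: filterI; first exact: near_mdist_lt.
  have : 0 < (nu g)^-1 by rewrite invr_gt0.
  move=> /(@near_rho_lt x); apply: filterS => w.
  by rewrite -[(nu g)^-1]mul1r ltr_pdivlMr// mulrC.
have := delta_invK g^-1%g x; rewrite invgK => near_inv.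
near=> u; exists (delta g x u); last by near: u.
by near: u; exact: (@delta_cvg_center g x _ near_w).
Unshelve. all: by end_near. Qed.

(** After a contraction [j] with [j * h] contracting, [j * g] is [j * h * k]; the triangle through
    the dilatation of [u] by [j * h] has both legs scaled by [nu (j * h)], and the factor [nu j]
    cancels. *)
Lemma act_rho_le g h u v : act_dom g u -> act_dom h v -> nu (g * h^-1)%g <= 1 ->
  rho x (delta g x u) (delta h x v) <=
    nu h * (rho x (delta (g * h^-1)%g x u) u + rho x u v).
Proof.
move=> gu hv; set k := (g * h^-1)%g => k1.
have xu := act_dom_sub gu; have xv := act_dom_sub hv.
have [|j jh1 /ltW j1] := @scale_lt_ex (1 / nu h); first by rewrite divr_gt0.
rewrite ltr_pdivlMr// -nuM in jh1.
have jgE : (j * g = j * h * k)%g by rewrite -mulgA [(h * _)%g]mulgC /k mulgVK.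
have jg1 : nu (j * g)%g <= 1 by rewrite jgE nuM mulr_ile1// ltW.
have rA m w (m1 : nu m <= 1) (xw : d x w < s1) : d x (delta m x w) <= A.
  exact/r_A/stable1.
have xuA := r_A (s1_r xu); have xvA := r_A (s1_r xv).
have xguA := r_A (act_image gu); have xhvA := r_A (act_image hv).
rewrite -(ler_pM2l (nu_gt0 j)) -(rho_scale j1 xguA xhvA); last 2 first.
- by rewrite act_comp//; exact: rA.
- by rewrite act_comp ?(ltW jh1)//; exact: (rA _ _ (ltW jh1)).
rewrite !act_comp ?(ltW jh1)// mulrA -nuM.
have jgu : delta (j * g)%g x u = delta (j * h)%g x (delta k x u).
  by rewrite delta_strong ?(ltW jh1)// jgE.
have jhu := rA _ _ (ltW jh1) xu; have jhv := rA _ _ (ltW jh1) xv.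
apply: le_trans (rho_triangle (rA _ _ jg1 xu) jhu jhv) _.
rewrite (rho_scale (ltW jh1) xuA xvA jhu jhv).
have jku : d x (delta (j * h)%g x (delta k x u)) <= A by rewrite -jgu; exact: rA.
rewrite jgu (rho_scale (ltW jh1) (rA _ _ k1 xu) xuA jku jhu).
by rewrite mulrDr.
Qed.

(** Compactness of the ball in [u] yields one neighbourhood of 1 for all [u]. The restriction
    [nu k <= 1] keeps the points inside the domain of continuity. *)
Lemma near_act_id (a : R) : 0 < a -> \forall k \near (1%g : G), forall u,
  d x u < s1 -> nu k <= 1 -> rho x (delta k x u) u < a.
Proof.
move=> a0; have [_ _ cr] := xr; have [c c0 cP] := rho_modulus xr a0.
have /compact_near_coveringP/near_covering_withinP := cr.
move=> /(_ G (nbhs (1%g : G)) (fun k u => nu k <= 1 -> d (delta k x u) u < c) _).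
have near_u u : cball x r u -> \forall u' \near u & k \near (1%g : G),
    cball x r u' -> nu k <= 1 -> d (delta k x u') u' < c.
  move=> xu.
  have A_of w : cball x r w -> d x w <= A := @good_radius_center _ _ xr w.
  pose F := within [set p : X * G | cball x r p.1 /\ nu p.2 <= 1] (nbhs (u, 1%g)).
  have Fu : p.1 @[p --> F] --> u by apply: cvg_within_filter; exact: cvg_fst.
  have lim : delta p.2 x p.1 @[p --> F] --> delta 1%g x u.
    apply: delta_cvg => //; first by apply: cvg_within_filter; exact: cvg_snd.
    - exact: cvg_cst.
    - by apply: dom_deltaE; rewrite ?(scale1 Hnu)//; exact/cball_dilU/A_of.
    - rewrite near_withinE; apply: nearW => p [/A_of xp p1].
      by apply: dom_deltaE => //; exact: cball_dilU.
  have d0 := cvg_mdist lim Fu.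
  rewrite (A1_id HA1 (cball_dilU (A_of _ xu))) mdistxx in d0.
  have : \forall p \near F, d (delta p.2 x p.1) p.1 < c.
    exact: cvgr_lt _ (d0 _) _ c0.
  rewrite near_withinE.
  by apply: filterS => -[w k] /= dk xw k1; exact: dk.
move=> /(_ near_u); apply: filterS => k kP u xu k1.
apply: cP; [exact/ltW/stable1|exact/ltW/s1_r|apply: kP => //].
exact/ltW/s1_r.
Qed.

Lemma act_unif (E : set (X * X)) : entourage E ->
  exists2 N : set G, nbhs 1%g N & exists2 E' : set (X * X), entourage E' &
    forall g h u v, act_dom g u -> act_dom h v -> N (g * h^-1)%g -> E' (u, v) ->
      E (delta g x u, delta h x v).
Proof.
rewrite -entourage_ballE => -[q q0 qE]; have [a a0 aP] := mdist_modulus xr q0.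
(* If [nu h <= C], [act_rho_le] bounds d^x by [C * (c + c) = a]. Otherwise [nu g > C / 2 >= 1], so
   both elements expand, and the images lie at d^x-distance below [2 / C] and [1 / C] from [x], in
   total less than [4 / C <= a]. *)
pose C := Num.max 2 (4 / a).
have [C2 Ca] : 2 <= C /\ 4 / a <= C by split; rewrite le_max lexx ?orbT.
have C0 : 0 < C by lra.
have Ca4 : 4 <= C * a by rewrite -ler_pdivrMr.
pose c := a / C / 2; have c0 : 0 < c by rewrite !divr_gt0.
have Cc : C * (c + c) = a by rewrite -splitr mulrC divfK// lt0r_neq0.
have [l l0 lP] := rho_modulus xr c0.
pose N k := 2^-1 < nu k < 2 /\
  forall u, d x u < s1 -> nu k <= 1 -> rho x (delta k x u) u < c.
have nN : \forall k \near (1%g : G), N k.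
  by apply: filterI; [exact: near_scale1|exact: near_act_id].
have half g h u v : act_dom g u -> act_dom h v -> N (g * h^-1)%g ->
    nu (g * h^-1)%g <= 1 -> d u v < l -> d (delta g x u) (delta h x v) < q.
  move=> gu hv [/andP[k2 _] kc] k1 uv.
  have xu := act_dom_sub gu; have xv := act_dom_sub hv.
  have xgu := act_image gu; have xhv := act_image hv.
  apply: aP; [exact: ltW|exact: ltW|].
  have [hC|hC] := leP (nu h) C.
    apply: le_lt_trans (act_rho_le gu hv k1) _; rewrite -Cc.
    have := kc u xu k1; have := lP u v (ltW (s1_r xu)) (ltW (s1_r xv)) uv.
    move=> ru rv.
    apply: (@lt_le_trans _ _ (nu h * (c + c))); first by rewrite ltr_pM2l//; lra.
    by rewrite ler_pM2r//; lra.
  have gh : nu h < 2 * nu g.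
    by move: k2; rewrite nuM nuV ltr_pdivlMr//; lra.
  have [|w g1 xw gw _ ->] := act_domP gu; first by lra.
  have [|w' h1 xw' hw _ ->] := act_domP hv; first by lra.
  have wA : d x w <= A by exact/r_A/s1_r/s2_s1.
  have w'A : d x w' <= A by exact/r_A/s1_r/s2_s1.
  apply: le_lt_trans (rho_triangle wA xx w'A) _; rewrite (rho_sym wA xx).
  have := rho_ge0 xx wA; have := rho_ge0 xx w'A; nra.
(* The estimate covers [nu (g * h^-1) <= 1]; a neighbourhood stable under inversion lets [g] and [h]
   be exchanged otherwise. *)
exists (N `&` [set k | N k^-1%g]).
  apply: filterI; first exact: nN.
  have : (fun k : G => k^-1%g) @ (1%g : G) --> (1%g : G).
    by have := @invg_continuous G 1%g; rewrite /continuous_at invg1.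
  exact.
exists [set p | ball p.1 l p.2]; first by exists l.
move=> g h u v gu hv [Nk NkV]; rewrite /= ballEmdist/= => uv.
apply: qE; rewrite /= ballEmdist/=; have [k1|k1] := leP (nu (g * h^-1)%g) 1.
  exact: half.
have kE : ((g * h^-1)^-1 = h * g^-1)%g by rewrite invgM invgK.
rewrite metric_sym; apply: half => //; rewrite -?kE//.
  by rewrite nuV invf_le1 ?(ltW k1).
by rewrite metric_sym.
Qed.

Lemma act_local_action : local_action (U x) x act_dom (fun g => delta g x).
Proof.
have r_U u : d x u < r -> U x u by move=> /r_A; exact: cball_dilU.
have near_inv g P : (\forall u \near x, P u) ->
    \forall u \near x, P (delta g^-1%g x u) := @delta_cvg_center g^-1%g x P.
split.
- by move=> g; split=> [|u /act_dom_sub/s1_r/r_U//]; exact: near_act_dom.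
- move=> g; split=> [|_ [u gu <-]]; last exact/r_U/act_image.
  apply: filterS2 (near_inv g _ (near_act_dom g)) (delta_invK g x) => u gu <-.
  by exists (delta g^-1%g x u).
- by move=> g; exact: delta_fix.
- exact: act_inj.
- exact: act_unif.
- move=> g h; near=> u; exists (delta h^-1%g x u); split.
  + by near: u; exact: near_inv (near_act_dom h).
  + by near: u; exact: delta_invK.
  + by near: u; exact: near_inv (near_act_dom g).
  + by near: u; exact: near_act_dom.
  + by near: u; exact: delta_comp.
Unshelve. all: by end_near. Qed.

End Action.

End DilatationFacts.

Theorem theorem10 (R : realType) (G : topologicalGroupType) (nu : G -> R)
    (Hnu : scale_morphism nu) (X : metricType R)
    (D : dilatation_data G X)
    (HD : dilatation_structure nu D) (HA2 : axiomA2_strong nu D) (x : X) :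
  exists (M : set (X * X)) (Dom : G -> set X),
    [/\ forall u v, M (u, v) ->
          (\forall e \near at0 nu, sum_defined nu D e x u v) /\
          sum_eps D e x u v @[e --> at0 nu] --> sum_lim nu D x u v,
        forall e, Dom e `<=` dil_dom nu D e x,
        conical_group nu (dilU D x) x M (sum_lim nu D x) Dom
          (fun e => dil D e x) &
        forall u, isometry_on (cball x (dilA D)) (tdist D x)
          [set v | M (u, v)] (sum_lim nu D x u)].
Proof.
have [Delta HDelta] := dil_A4 HD.
have [s xs] := tangent_radius_ex Hnu HD HDelta x.
have [t [b tb]] := group_radius_ex Hnu HD HA2 xs.
have [b0 bt ts _ sumP] := tb; have [_ xrs _] := xs.
have [r xr] := good_radius_ex HD x; have [r0 _ _] := xr.
(* Stability is used at two levels: contractions map the [s1]-ball into the [r]-ball, and the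
   [s2]-ball into the [s1]-ball. The second level keeps the domains of expanding elements, which are
   images of [s2]-small points, inside the [s1]-ball. *)
have [a1 a10 a1P] := delta_stable Hnu HD HA2 x r0.
pose s1 := Num.min a1 r; have s10 : 0 < s1 by rewrite lt_min a10.
have [a2 a20 a2P] := delta_stable Hnu HD HA2 x s10.
pose s2 := Num.min a2 s1; have s20 : 0 < s2 by rewrite lt_min a20.
have s12 : 0 < s2 /\ s2 <= s1 <= r.
  by split=> //; apply/andP; split; rewrite ge_min lexx orbT.
have stable1 g u : nu g <= 1 -> mdist x u < s1 -> mdist x (dil D g x u) < r.
  by move=> g1; rewrite lt_min => /andP[xu _]; exact: a1P.
have stable2 g u : nu g <= 1 -> mdist x u < s2 -> mdist x (dil D g x u) < s1.
  by move=> g1 xu; apply: a2P => //; apply: lt_le_trans xu _; rewrite ge_min lexx.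
pose M : set (X * X) := [set p | mdist x p.1 < b /\ mdist x p.2 < b].
pose Dom := @act_dom R G nu X D x s1 s2.
have near_Dom g : \forall u \near x, Dom g u := near_act_dom Hnu HD HA2 x s12 g.
have fst_near P : (\forall u \near x, P u) -> \forall p \near (x, x), P p.1.
  exact: cvg_fst.
have snd_near P : (\forall u \near x, P u) -> \forall p \near (x, x), P p.2.
  exact: cvg_snd.
exists M, Dom; split.
- by move=> u v [/= xu xv]; have [] := sumP u v xu xv.
- by move=> g u; exact: (act_dom_dil Hnu HD xr s12).
- split.
  + exact: (sum_local_group Hnu HD HA2 xs tb).
  + exact: (act_local_action Hnu HD HA2 xr s12 stable1 stable2).
  + move=> g; near=> p; rewrite [p]surjective_pairing; split.
    * split; near: p; first exact: near_ball2.
      exact: (delta2_cvg Hnu HD HA2 g) _ (near_ball2 x b0).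
    * by near: p; exact: fst_near (near_Dom g).
    * by near: p; exact: snd_near (near_Dom g).
    * by near: p; exact: (near_sum Hnu HD HA2 xs (near_Dom g)).
    * by near: p; exact: (sum_morph Hnu HD HA2 xs tb g).
  + exists [set u | mdist x u < s1]; first exact: near_mdist_lt.
    split.
      by apply: filterS (at0_le ltr01) => g g1; rewrite /Dom /act_dom g1.
    move=> u xu; apply: (A1_lim (dil_A1 HD)).
    apply: (cball_dilU HD); apply: (good_radius_center HD xr); apply: ltW.
    by apply: lt_le_trans xu _; have [_ /andP[]] := s12.
move=> u; split=> [v [_ xv]|_ [v [xu xv] <-]|v w [xu xv] [_ xw]].
- apply: (good_radius_center HD xrs); apply: ltW.
  exact: lt_trans (lt_le_trans xv bt) ts.
- have [_ _ xuv _] := sumP u v xu xv.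
  by apply: (good_radius_center HD xrs); rewrite ltW// (lt_trans xuv).
- exact: (sum_rho Hnu HD xs tb).
Unshelve. all: by end_near. Qed.
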